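(* Let $k \geq 1$ be an integer. Then: (1) (Extremisers) For every ergodic system $X = (X,\mathcal{X},\mu,T)$ and every $f \in L^\infty(X)$ with $\|f\|_{L^\infty(X)} \leq 1$, one has $\|f\|_{U^k(X)} = 1$ if and only if $f = e(P)$ almost everywhere for some polynomial $P: X \to \mathbf{R}/\mathbf{Z}$ of degree $\leq k-1$. (2) (Near-extremisers) There is a function $c_k:[0,\infty)\to[0,\infty)$ depending only on $k$ with $c_k(\varepsilon)\to 0$ as $\varepsilon \to 0$ such that for every ergodic system $X$, every $f \in L^\infty(X)$ with $\|f\|_{L^\infty(X)} \leq 1$ and every $\varepsilon \geq 0$: if $\|f\|_{U^k(X)} \geq 1-\varepsilon$, then there exists a polynomial $P: X \to \mathbf{R}/\mathbf{Z}$ of degree $\leq k-1$ with $\|f-e(P)\|_{L^1(X)} \leq c_k(\varepsilon)$.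
   Context: An ergodic system $(X,\mathcal{X},\mu,T)$ is a probability space with an invertible, bimeasurable, measure-preserving map $T$ such that the only $T$-invariant functions in $L^2(X)$ are the (a.e.) constants. For $h\in\mathbf{Z}$, $T^h f := f \circ T^{-h}$. The Gowers–Host–Kra seminorms are defined recursively by $\|f\|_{U^1(X)} := |\int_X f\,d\mu|$ and $\|f\|_{U^{k+1}(X)} := \lim_{H\to\infty}\left(\mathbb{E}_{h \in [H]} \|(T^h f)\overline{f}\|_{U^k(X)}^{2^k}\right)^{1/2^{k+1}}$ (the limit exists), where $[H] = \{1,\dots,H\}$ and $\mathbb{E}_{h\in[H]} = \frac1H\sum_{h=1}^H$. A measurable map $P: X \to \mathbf{R}/\mathbf{Z}$ is a polynomial of degree $\leq d$ if $\Delta_{h_1}\cdots\Delta_{h_{d+1}} P = 0$ $\mu$-a.e. for every $h_1,\dots,h_{d+1} \in \mathbf{Z}$, where $\Delta_h := T^h - 1$. $e(x) := e^{2\pi i x}$. *)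

(* Defs.v *)
From HB Require Import structures.
From mathcomp Require Import all_boot all_order all_algebra.
From mathcomp Require Import all_classical all_reals all_analysis.
Set Implicit Arguments. Unset Strict Implicit. Unset Printing Implicit Defensive.
Import Order.TTheory GRing.Theory Num.Theory.
Import numFieldNormedType.Exports.
Local Open Scope classical_set_scope.
Local Open Scope ring_scope.

(* Complex numbers are represented as pairs (real part, imaginary part) in R * R. *)
Section Gowers.
Context {R : realType} {d : measure_display} {X : measurableType d}.

Definition cmul (z w : R * R) : R * R := (z.1 * w.1 - z.2 * w.2, z.1 * w.2 + z.2 * w.1).
Definition cconj (z : R * R) : R * R := (z.1, - z.2).
Definition cabs (z : R * R) : R := Num.sqrt (z.1 ^+ 2 + z.2 ^+ 2).
Definition cexp2pi (x : R) : R * R := (cos (2 * pi * x), sin (2 * pi * x)).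

Definition Tpow (T Tinv : X -> X) (n : int) : X -> X :=
  match n with
  | Posz m => iter m T
  | Negz m => iter m.+1 Tinv
  end.

Definition mps (mu : probability X R) (T Tinv : X -> X) : Prop :=
  [/\ cancel T Tinv, cancel Tinv T,
      measurable_fun setT T, measurable_fun setT Tinv &
      forall A, measurable A -> mu (T @^-1` A) = mu A].

Definition cmeasurable (f : X -> R * R) : Prop :=
  measurable_fun setT (fun x => (f x).1) /\ measurable_fun setT (fun x => (f x).2).

Definition ergodic (mu : probability X R) (T : X -> X) : Prop :=
  forall g : X -> R * R, cmeasurable g ->
    mu.-integrable setT (fun x => ((g x).1 ^+ 2 + (g x).2 ^+ 2)%:E) ->
    {ae mu, forall x, g (T x) = g x} ->
    exists c : R * R, {ae mu, forall x, g x = c}.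

Definition cintegral (mu : probability X R) (f : X -> R * R) : R * R :=
  (Rintegral mu setT (fun x => (f x).1), Rintegral mu setT (fun x => (f x).2)).

Definition shiftf (T Tinv : X -> X) (h : int) (f : X -> R * R) : X -> R * R :=
  fun x => f (Tpow T Tinv (- h) x).

(* gowers_aux n f = ||f||_{U^{n+1}(X)} *)
Fixpoint gowers_aux (mu : probability X R) (T Tinv : X -> X) (n : nat)
    (f : X -> R * R) : R :=
  match n with
  | 0 => cabs (cintegral mu f)
  | n'.+1 =>
      limn (fun H : nat =>
        ((H%:R)^-1 * \sum_(1 <= h < H.+1)
           gowers_aux mu T Tinv n'
             (fun x => cmul (shiftf T Tinv (Posz h) f x) (cconj (f x))) ^+ (2 ^ n'.+1)%N)
        `^ ((2 ^ n'.+2)%N%:R)^-1)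
  end.

Definition gowers (mu : probability X R) (T Tinv : X -> X) (k : nat)
    (f : X -> R * R) : R := gowers_aux mu T Tinv k.-1 f.

(* Delta_h P = T^h P - P ; representatives of R/Z-valued maps are real-valued *)
Definition delta (T Tinv : X -> X) (h : int) (P : X -> R) : X -> R :=
  fun x => P (Tpow T Tinv (- h) x) - P x.

Definition deltas (T Tinv : X -> X) (hs : seq int) (P : X -> R) : X -> R :=
  foldr (delta T Tinv) P hs.

(* P : X -> R/Z (given by a measurable real lift) is a polynomial of degree <= deg *)
Definition poly_deg (mu : probability X R) (T Tinv : X -> X) (deg : nat)
    (P : X -> R) : Prop :=
  measurable_fun setT P /\
  forall hs : seq int, size hs = deg.+1 ->
    {ae mu, forall x, deltas T Tinv hs P x \is a Num.int}.

Definition linf_le1 (mu : probability X R) (f : X -> R * R) : Prop :=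
  cmeasurable f /\ {ae mu, forall x, cabs (f x) <= 1}.

Definition L1dist (mu : probability X R) (f g : X -> R * R) : R :=
  Rintegral mu setT (fun x => cabs ((f x).1 - (g x).1, (f x).2 - (g x).2)).

End Gowers.

(* Main.v *)
(** The theorem is proved by induction on [k]. A large [U^(k+1)] norm makes
    [T^h f * conj f] close to a phase polynomial [e(P_h)] of degree [< k] for
    most [h], hence, taking quotients of two good directions, for every [h].
    Phase polynomials of bounded degree that are close are equal up to a
    constant, which makes [h |-> e(P_h)] a cocycle up to constants; these form
    an approximate character of the integers and can be corrected by a true
    one. Now [f] is almost invariant under a unitary twisted by a true cocycle,
    and the element of minimal norm among the functions with twisted orbit
    close to [f] is invariant: after normalisation it is [e(P)] with
    [Delta_1 P] of degree [< k].

    The limits defining the seminorms are never shown to exist: a divergent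
    sequence has the junk limit [0], so a seminorm close to [1] is a limit. *)
Require Import Defs.
From HB Require Import structures.
From mathcomp Require Import all_boot all_order all_algebra.
From mathcomp Require Import ring lra.
From mathcomp Require Import all_classical all_reals all_analysis.
From mathcomp Require Import measurable_realfun.
Set Implicit Arguments. Unset Strict Implicit. Unset Printing Implicit Defensive.
Import Order.TTheory GRing.Theory Num.Theory.
Import numFieldNormedType.Exports.
Local Open Scope classical_set_scope.
Local Open Scope ring_scope.

(** * Complex numbers as pairs and the exponential *)

Section ComplexPairs.
Context {R : realType}.
Implicit Types (z w u v : R * R) (x y t : R).

(** Errors are measured by the square of the L^2 distance: products and triangle inequalities then
    cost only numerical factors, and Hilbert space geometry is available for the minimal-norm
    argument. The L^1 bound comes back through a square root. The obstacle is that errors must not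
    accumulate along the cocycle: [h] is unbounded, while the required smallness may depend neither
    on [h] nor on the system. Rigidity, used afresh at each [h], turns a small error into an exact
    identity up to a constant, so that only numbers remain to be corrected. A second defect is that
    [f] is merely near modulus one, so that products of its derivatives carry factors [|f|^2]; a
    single good direction already forces [|f|^2] to be near [1]. The exact statement (1) is deduced
    from the approximate one: the polynomials that approximate [f] at all scales agree up to
    constants. *)

Definition abs2 z : R := z.1 ^+ 2 + z.2 ^+ 2.

Lemma abs2_ge0 z : 0 <= abs2 z.
Proof. by rewrite addr_ge0 ?sqr_ge0. Qed.

Lemma abs2_eq0 z : abs2 z = 0 -> z = 0.
Proof.
case: z => a b /eqP; rewrite /abs2 /= paddr_eq0 ?sqr_ge0// !sqrf_eq0.
by move=> /andP[/eqP-> /eqP->].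
Qed.

Lemma abs2_cmul z w : abs2 (cmul z w) = abs2 z * abs2 w.
Proof. by rewrite /abs2 /cmul /=; ring. Qed.

Lemma abs2_cconj z : abs2 (cconj z) = abs2 z.
Proof. by rewrite /abs2 /cconj /= sqrrN. Qed.

Lemma abs2C z w : abs2 (z - w) = abs2 (w - z).
Proof. by rewrite /abs2 /=; ring. Qed.

Lemma abs2_1 : abs2 (1, 0) = 1 :> R.
Proof. by rewrite /abs2 /=; ring. Qed.

Lemma abs2_sub_real x y : abs2 ((x, 0) - (y, 0)) = (x - y) ^+ 2.
Proof. by rewrite /abs2 /=; ring. Qed.

Lemma abs2_triangle u v w : abs2 (u - w) <= 2 * abs2 (u - v) + 2 * abs2 (v - w).
Proof.
rewrite -subr_ge0.
have -> : 2 * abs2 (u - v) + 2 * abs2 (v - w) - abs2 (u - w) =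
  abs2 (u - v - (v - w)) by rewrite /abs2 /=; ring.
exact: abs2_ge0.
Qed.

Lemma abs2_subM u v z w : abs2 v <= 1 -> abs2 z <= 1 ->
  abs2 (cmul u v - cmul z w) <= 2 * abs2 (u - z) + 2 * abs2 (v - w).
Proof.
move=> v1 z1; apply: (le_trans (abs2_triangle _ (cmul z v) _)).
have -> : cmul u v - cmul z v = cmul (u - z) v.
  by rewrite /cmul; congr pair => /=; ring.
have -> : cmul z v - cmul z w = cmul z (v - w).
  by rewrite /cmul; congr pair => /=; ring.
rewrite !abs2_cmul lerD// ler_wpM2l//.
  by rewrite ler_piMr ?abs2_ge0.
by rewrite ler_piMl ?abs2_ge0.
Qed.

Lemma abs2_mid u v w :
  abs2 (((u.1 + v.1) / 2, (u.2 + v.2) / 2) - w) <=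
  (abs2 (u - w) + abs2 (v - w)) / 2.
Proof.
rewrite -subr_ge0.
set d := (X in 0 <= X).
have -> : d = abs2 (u - v) / 4 by rewrite /d /abs2 /=; field.
by rewrite divr_ge0// abs2_ge0.
Qed.

Lemma abs2_parallelogram u v :
  abs2 (u - v) = 2 * abs2 u + 2 * abs2 v - 4 * abs2 ((u.1 + v.1) / 2, (u.2 + v.2) / 2).
Proof. by rewrite /abs2 /=; field. Qed.

Lemma cabsE z : cabs z = Num.sqrt (abs2 z). Proof. by []. Qed.

Lemma cabs_ge0 z : 0 <= cabs z. Proof. exact: sqrtr_ge0. Qed.

Lemma sqr_cabs z : cabs z ^+ 2 = abs2 z.
Proof. by rewrite cabsE sqr_sqrtr// abs2_ge0. Qed.

Lemma cabs_le1 z : (cabs z <= 1) = (abs2 z <= 1).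
Proof.
by rewrite -sqr_cabs -{2}(expr1n _ 2) ler_pXn2r// ?nnegrE ?cabs_ge0.
Qed.

Lemma abs2_le1_components z : abs2 z <= 1 -> `|z.1| <= 1 /\ `|z.2| <= 1.
Proof.
by rewrite /abs2 => h; split; rewrite ler_norml; apply/andP; split; nra.
Qed.

Lemma cmulC z w : cmul z w = cmul w z.
Proof. by rewrite /cmul; congr pair; ring. Qed.

Lemma cmulA z w u : cmul z (cmul w u) = cmul (cmul z w) u.
Proof. by rewrite /cmul; congr pair => /=; ring. Qed.

Lemma cmul1z z : cmul (1, 0) z = z.
Proof. by case: z => a b; rewrite /cmul; congr pair => /=; ring. Qed.

Lemma cmulz1 z : cmul z (1, 0) = z.
Proof. by rewrite cmulC cmul1z. Qed.

Lemma cmul_conj z : cmul z (cconj z) = (abs2 z, 0).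
Proof. by rewrite /cmul /abs2; congr pair => /=; ring. Qed.

Lemma cconjB z w : cconj (z - w) = cconj z - cconj w.
Proof. by rewrite /cconj; apply: injective_projections => /=; ring. Qed.

Lemma abs2_exp x : abs2 (cexp2pi x) = 1.
Proof. by rewrite /abs2 /= cos2Dsin2. Qed.

Lemma cexpD x y : cexp2pi (x + y) = cmul (cexp2pi x) (cexp2pi y).
Proof.
by rewrite /cexp2pi mulrDr cosD sinD /cmul; congr pair => /=; ring.
Qed.

Lemma cexpN x : cexp2pi (- x) = cconj (cexp2pi x).
Proof. by rewrite /cexp2pi mulrN cosN sinN. Qed.

Lemma cexp0 : cexp2pi 0 = (1, 0) :> R * R.
Proof. by rewrite /cexp2pi mulr0 cos0 sin0. Qed.

Lemma cexpB x y : cexp2pi (x - y) = cmul (cexp2pi x) (cconj (cexp2pi y)).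
Proof. by rewrite cexpD cexpN. Qed.

Lemma cexp_dist x y :
  abs2 (cexp2pi x - cexp2pi y) = abs2 (cexp2pi (x - y) - (1, 0)).
Proof.
have -> : cexp2pi x - cexp2pi y = cmul (cexp2pi (x - y) - (1, 0)) (cexp2pi y).
  rewrite -{1}(subrK y x) [in LHS]cexpD; move: (cexp2pi (x - y)) (cexp2pi y) => a b.
  by rewrite /cmul; apply: injective_projections => /=; ring.
by rewrite abs2_cmul abs2_exp mulr1.
Qed.

Lemma cexp_int x : x \is a Num.int -> cexp2pi x = (1, 0).
Proof.
have cexp_nat n : cexp2pi n%:R = (1, 0) :> R * R.
  elim: n => [|n IH]; first by rewrite cexp0.
  rewrite -natr1 cexpD IH cmul1z /cexp2pi mulr1.
  have -> : 2 * pi = pi *+ 2 :> R by rewrite mulr2n; ring.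
  by rewrite cos2pi sin2pi.
move=> /intrP[[n|n] ->]; first exact: cexp_nat.
by rewrite NegzE rmorphN /= cexpN cexp_nat /cconj /= oppr0.
Qed.

Lemma abs2_exp_sub1 x : abs2 (cexp2pi x - (1, 0)) = 2 - 2 * cos (2 * pi * x).
Proof.
rewrite /abs2 /cexp2pi /=; have := cos2Dsin2 (2 * pi * x).
by move: (cos _) (sin _) => c s h; nra.
Qed.

Lemma cos_mul_norm x y : cos (x * `|y|) = cos (x * y).
Proof. by case: (ger0P y) => _; rewrite ?mulrN ?cosN. Qed.

(** The chord [|e(t) - 1|] depends only on [cos], which decreases on [[0, pi]]; a chord no longer
    than that of [d] therefore keeps [t] within [d] of its nearest integer. *)
Lemma cexp_near_int (dl : R) : 0 < dl -> exists2 k : R, 0 < k &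
  forall t, abs2 (cexp2pi t - (1, 0)) <= k ->
  exists2 n, n \is a Num.int & `|t - n| <= dl.
Proof.
(* The cap [1/2] keeps [2 * pi * d] in [[0, pi]]. *)
move=> dl0; pose d := Num.min dl 2^-1.
have d0 : 0 < d by rewrite lt_min dl0 invr_gt0 ltr0n.
have d2 : d <= 2^-1 by rewrite ge_min lexx orbT.
have ddl : d <= dl by rewrite ge_min lexx.
have pi0 := pi_gt0 R.
exists (2 - 2 * cos (2 * pi * d)).
  suff : cos (2 * pi * d) < cos 0 by rewrite cos0 => ?; lra.
  have dpi : 0 < 2 * pi * d <= pi by apply/andP; split; nra.
  case/andP: dpi => dpi0 dpi1.
  by rewrite ltr_cos ?in_itv /= ?lexx ?(ltW dpi0) ?dpi1 ?ltW.
move=> t; rewrite abs2_exp_sub1 => h.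
pose n : R := (Num.floor (t + 2^-1))%:~R.
have nint : n \is a Num.int by rewrite intr_int.
exists n => //; apply: le_trans ddl.
have [n1 n2] : n <= t + 2^-1 /\ t + 2^-1 < n + 1.
  split; first exact: ge_floor.
  by rewrite /n -[1]/(1%:~R) -intrD; exact: floorD1_gt.
have tn : `|t - n| <= 2^-1 by rewrite ler_norml; apply/andP; split; lra.
rewrite leNgt; apply/negP => ltd.
have : cos (2 * pi * `|t - n|) < cos (2 * pi * d).
  have ? := normr_ge0 (t - n).
  by rewrite ltr_cos ?in_itv /=; nra.
have -> : cos (2 * pi * `|t - n|) = cos (2 * pi * t).
  rewrite cos_mul_norm.
  have : cexp2pi (t - n) = cexp2pi t.
    by rewrite cexpB (cexp_int nint) /cmul /cexp2pi /=; congr pair; ring.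
  by move=> /(congr1 fst).
move=> hc; lra.
Qed.

Lemma cexp_eq1 x : cexp2pi x = (1, 0) -> x \is a Num.int.
Proof.
move=> x1.
(* Radius [1/3] puts [2 * pi * |x - n|] in [[0, pi]], where [cos] is injective. *)
have [k k0 hk] := @cexp_near_int 3^-1 ltac:(by rewrite invr_gt0).
have a0 : abs2 (cexp2pi x - (1, 0)) = 0 by rewrite x1 subrr /abs2 /= expr0n /= addr0.
have [n nint xn] := hk x ltac:(by rewrite a0 ltW).
suff -> : x = n by [].
have pi0 := pi_gt0 R.
have e1 : cexp2pi (x - n) = (1, 0) by rewrite cexpB x1 cexp_int// /cmul /cconj /=; congr pair; ring.
have c1 : cos (2 * pi * `|x - n|) = cos 0.
  by rewrite cos_mul_norm cos0; have := congr1 fst e1.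
have := normr_ge0 (x - n) => ?.
have : 2 * pi * `|x - n| = 0.
  by apply: (cos_inj _ _ c1); rewrite in_itv /=; apply/andP; split; nra.
move/eqP; rewrite mulf_eq0 mulf_eq0 (gt_eqF pi0) pnatr_eq0 /= normr_eq0 subr_eq0.
by move/eqP.
Qed.

Lemma cexp_eq x y : cexp2pi x = cexp2pi y <-> x - y \is a Num.int.
Proof.
split=> [xy|/cexp_int]; first by apply: cexp_eq1; rewrite cexpB xy cmul_conj abs2_exp.
move=> h; rewrite -(subrK y x) cexpD h cmul1z//.
Qed.

(** * Approximate characters of the integers *)

Lemma cexp_cont (k : R) : 0 < k -> exists2 dl : R, 0 < dl &
  forall t, `|t| <= dl -> abs2 (cexp2pi t - (1, 0)) <= k.
Proof.
move=> k0.
have : (2 - 2 * cos (2 * pi * t)) @[t --> (0 : R)] --> (2 - 2 * cos (2 * pi * 0) : R).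
  apply: cvgB; first exact: cvg_cst.
  apply: cvgM; first exact: cvg_cst.
  apply: (@continuous_comp R R R (fun t => 2 * pi * t) cos 0); last exact: continuous_cos.
  by apply: cvgM; [exact: cvg_cst|exact: cvg_id].
rewrite mulr0 cos0 mulr1 subrr => /cvgrPdist_le /(_ k k0).
move=> /nbhs_ballP[dl /= dl0 h]; exists (dl / 2); first by rewrite divr_gt0.
move=> t tdl; rewrite abs2_exp_sub1.
have := h t; rewrite /ball /= sub0r normrN => /(_ _).
rewrite (le_lt_trans tdl) ?ltr_pdivrMr// => [|]; last by rewrite mulr_natr mulr2n ltrDl.
move=> /(_ isT); rewrite sub0r normrN; apply: le_trans; exact: ler_norm.
Qed.

(* The sup of the [(theta h - dl) / h] works because [theta - dl] is
   superadditive and [theta + dl] is subadditive. *)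
Lemma quasimorphism_linear (dl : R) (theta : nat -> R) : 0 <= dl ->
  (forall h k, `|theta (h + k)%N - theta h - theta k| <= dl) ->
  exists a : R, forall h, `|theta h - a * h%:R| <= dl.
Proof.
move=> dl0 H.
have lo h k : (k.+1%:R * (theta h - dl) <= theta (k.+1 * h)%N - dl).
  elim: k => [|k IH]; first by rewrite mul1n mul1r.
  have := H h (k.+1 * h)%N; rewrite -mulSn ler_norml => /andP[h1 _].
  move: IH h1; rewrite -(natr1 k.+1) mulrDl mul1r; set a := _ * (_ - _); lra.
have hi h k : (theta (k.+1 * h)%N + dl <= k.+1%:R * (theta h + dl)).
  elim: k => [|k IH]; first by rewrite mul1n mul1r.
  have := H h (k.+1 * h)%N; rewrite -mulSn ler_norml => /andP[_ h1].
  move: IH h1; rewrite -(natr1 k.+1) mulrDl mul1r; set a := _ * (_ + _); lra.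
have key h k : (theta h.+1 - dl) / h.+1%:R <= (theta k.+1 + dl) / k.+1%:R.
  rewrite ler_pdivrMr ?ltr0n// mulrAC ler_pdivlMr ?ltr0n//.
  have := lo h.+1 k; have := hi k.+1 h; rewrite (mulnC h.+1).
  by rewrite mulrC (mulrC (_ + _)); lra.
pose A := [set (theta h.+1 - dl) / h.+1%:R | h in [set: nat]].
have supA : has_sup A.
  split; first by exists ((theta 1%N - dl) / 1%:R); exists 0%N.
  by exists ((theta 1%N + dl) / 1%:R) => _ [h _ <-]; exact: key.
exists (sup A) => -[|h].
  by have := H 0%N 0%N; rewrite addn0 subrr sub0r normrN mulr0 subr0.
have l : (theta h.+1 - dl) / h.+1%:R <= sup A by apply: sup_ubound; [exact: supA.2|exists h].
have u : sup A <= (theta h.+1 + dl) / h.+1%:R.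
  by apply: ge_sup; [exact: supA.1|move=> _ [k _ <-]; exact: key].
move: l u; rewrite ler_pdivrMr ?ltr0n// ler_pdivlMr ?ltr0n// => l u.
by rewrite ler_norml; apply/andP; split; lra.
Qed.

(** Phases that are multiplicative up to a small error lift, one step at a time, to reals that are
    additive up to a small error. Such a quasimorphism stays at bounded distance from a linear map,
    with a bound independent of [h]. *)
Lemma approx_character (k : R) : 0 < k -> exists2 k0 : R, 0 < k0 &
  forall t : nat -> R,
    (forall h l, abs2 (cexp2pi (t (h + l)%N) - cexp2pi (t h + t l)) <= k0) ->
  exists a : R, forall h, abs2 (cexp2pi (t h) - cexp2pi (a * h%:R)) <= k.
Proof.
move=> k_gt0.
have [d d0 hd] := cexp_cont k_gt0.
(* With [dl <= 1/8], an integer within [4 * dl] of [0] is [0], which keeps the additive defect from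
   growing. *)
pose dl := Num.min d 8^-1.
have dl0 : 0 < dl by rewrite lt_min d0 invr_gt0 ltr0n.
have dld : dl <= d by rewrite ge_min lexx.
have dl8 : dl <= 8^-1 by rewrite ge_min lexx orbT.
have [k0 k00 hk0] := cexp_near_int dl0.
exists k0 => // t ht.
have near h l : exists2 n, n \is a Num.int & `|t (h + l)%N - (t h + t l) - n| <= dl.
  by apply: hk0; rewrite -cexp_dist.
(* In the witness, [n] removes the integer part of the defect and [y - t h] carries along the
   integer accumulated so far. The premise sits inside the existential so that choice yields a total
   function [next]. *)
have lift_step h y : exists y', [/\ y - t h \is a Num.int ->
    y' - t h.+1 \is a Num.int & y - t h \is a Num.int -> `|y' - y - t 1%N| <= dl].
  have [n nint hn] := near h 1%N; exists (t h.+1 - n + (y - t h)).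
  rewrite addn1 in hn; split=> [yt|_].
    have -> : t h.+1 - n + (y - t h) - t h.+1 = (y - t h) - n by ring.
    exact: rpredB.
  by have -> : t h.+1 - n + (y - t h) - y - t 1%N = t h.+1 - (t h + t 1%N) - n by ring.
have [next hnext] := choice (fun p : nat * R => lift_step p.1 p.2).
(* For [h = l = 0] the defect is [- t 0], so [t 0 + n0] is a lift within [dl] of [0]. *)
have [n0 n0int hn0] := near 0%N 0%N.
pose theta := fix theta h := if h is h'.+1 then next (h', theta h') else t 0%N + n0.
have thint h : theta h - t h \is a Num.int.
  elim: h => [|h IH]; first by rewrite /= addrAC subrr add0r.
  by have [+ _] := hnext (h, theta h); exact.
have thstep h : `|theta h.+1 - theta h - t 1%N| <= dl.
  by have [_ h2] := hnext (h, theta h); exact: h2 (thint h).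
have th0 : `|theta 0%N| <= dl.
  move: hn0; rewrite addn0 /= (_ : _ - n0 = - (t 0%N + n0)) ?normrN//; ring.
clearbody theta.
(* The defect of [theta] is within [dl] of an integer and, by induction, at
   most [4 dl < 1 - dl] in absolute value. *)
have thquasi h l : `|theta (h + l)%N - theta h - theta l| <= dl.
  elim: l => [|l IH]; first by rewrite addn0 subrr sub0r normrN.
  have [n nint hn] := near h l.+1.
  have s1 := thstep (h + l)%N; have s2 := thstep l; rewrite addnS in hn *.
  have [i1 i2 i3] := And3 (thint (h + l).+1) (thint h) (thint l.+1).
  set b := theta _ - _ - _.
  pose m := b - (t (h + l).+1 - (t h + t l.+1)) + n.
  have mint : m \is a Num.int.
    have -> : m = (theta (h + l).+1 - t (h + l).+1) - (theta h - t h) -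
      (theta l.+1 - t l.+1) + n by rewrite /m /b; ring.
    by apply: rpredD => //; apply: rpredB => //; exact: rpredB.
  have bm : `|b - m| <= dl.
    by have -> : b - m = t (h + l).+1 - (t h + t l.+1) - n by rewrite /m; ring.
  have b3 : `|b| <= 3 * dl.
    move: IH s1 s2; rewrite /b !ler_norml => /andP[? ?] /andP[? ?] /andP[? ?].
    by apply/andP; split; lra.
  suff m0 : m = 0 by rewrite m0 subr0 in bm.
  have m1 : `|m| < 1.
    clear -b3 bm dl8; move: b3 bm; rewrite ltr_norml !ler_norml.
    by move=> /andP[? ?] /andP[? ?]; apply/andP; split; lra.
  by apply/eqP; apply: contraLR m1 => m0; rewrite -leNgt norm_intr_ge1.
have [a ha] := quasimorphism_linear (ltW dl0) thquasi.
exists a => h.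
rewrite (_ : cexp2pi (t h) = cexp2pi (theta h)); last first.
  by apply/esym/cexp_eq; exact: thint.
by rewrite cexp_dist hd// (le_trans (ha h)).
Qed.

(** Clipping the real part makes the [acos] term monotone on the whole line, hence measurable; on
    the unit circle it changes nothing. *)
Definition carg z : R :=
  let a := acos (Num.max (-1) (Num.min 1 z.1)) / (2 * pi) in
  if 0 <= z.2 then a else - a.

Lemma cargK z : abs2 z = 1 -> cexp2pi (carg z) = z.
Proof.
case: z => a b; rewrite /abs2 /= => ab.
have a1 : -1 <= a <= 1 by apply/andP; split; nra.
have pi0 := pi_gt0 R.
have e1 : Num.max (-1) (Num.min 1 a) = a.
  case/andP: a1 => h1 h2.
  by rewrite min_r// max_r.
have E : cexp2pi (acos a / (2 * pi)) = (a, `|b|).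
  rewrite /cexp2pi mulrC divfK ?gt_eqF ?mulr_gt0//.
  rewrite acosK ?in_itv//= sin_acos//; congr pair.
  by rewrite -sqrtr_sqr; congr Num.sqrt; rewrite -ab; ring.
rewrite /carg /= e1; case: ifPn => b0; first by rewrite E ger0_norm.
by rewrite cexpN E /cconj /= ltr0_norm ?opprK// ltNge.
Qed.

End ComplexPairs.

(** * Bounded functions on a probability space *)

Section BoundedIntegrals.
Context {R : realType} {d : measure_display} {X : measurableType d}.
Variable mu : probability X R.
Implicit Types (g h : X -> R) (u v w : X -> R * R) (S : X -> X).

Definition bmeas g := measurable_fun setT g /\ exists M : R, forall x, `|g x| <= M.

Local Notation Int g := (Rintegral mu setT g).

Lemma bmeas_integrable g : bmeas g -> mu.-integrable setT (EFin \o g).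
Proof.
move=> [mg [M gM]]; apply: measurable_bounded_integrable => //.
  by apply: (@le_lt_trans _ _ 1%E); [exact: probability_le1|exact: ltry].
exists M; split; first exact: num_real.
by move=> y My x _ /=; rewrite (le_trans (gM x)) ?ltW.
Qed.

Lemma bmeas_cst c : bmeas (fun=> c).
Proof. by split; [exact: measurable_cst|exists `|c|]. Qed.

Lemma bmeasD g h : bmeas g -> bmeas h -> bmeas (fun x => g x + h x).
Proof.
move=> [mg [M gM]] [mh [N hN]]; split; first exact: measurable_funD.
by exists (M + N) => x; rewrite (le_trans (ler_normD _ _))// lerD.
Qed.

Lemma bmeasM g h : bmeas g -> bmeas h -> bmeas (fun x => g x * h x).
Proof.
move=> [mg [M gM]] [mh [N hN]]; split; first exact: measurable_funM.
by exists (M * N) => x; rewrite normrM ler_pM.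
Qed.

Lemma bmeasZ c g : bmeas g -> bmeas (fun x => c * g x).
Proof. by move=> mg; apply: bmeasM => //; exact: bmeas_cst. Qed.

Lemma bmeasN g : bmeas g -> bmeas (fun x => - g x).
Proof.
move=> bg; rewrite (_ : (fun _ => _) = (fun x => -1 * g x)); first exact: bmeasZ.
by apply/funext => x; rewrite mulN1r.
Qed.

Lemma bmeasB g h : bmeas g -> bmeas h -> bmeas (fun x => g x - h x).
Proof. by move=> bg bh; apply: bmeasD => //; exact: bmeasN. Qed.

Lemma bmeas_sqr g : bmeas g -> bmeas (fun x => g x ^+ 2).
Proof. by move=> bg; under eq_fun do rewrite expr2; exact: bmeasM. Qed.

Lemma bmeas_comp g S : measurable_fun setT S -> bmeas g -> bmeas (fun x => g (S x)).
Proof.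
move=> mS [mg [M gM]]; split; last by exists M => x.
exact: (measurableT_comp mg mS).
Qed.

Lemma Rint_add g h : bmeas g -> bmeas h -> Int (fun x => g x + h x) = Int g + Int h.
Proof. by move=> bg bh; rewrite RintegralD//; exact: bmeas_integrable. Qed.

Lemma Rint_sub g h : bmeas g -> bmeas h -> Int (fun x => g x - h x) = Int g - Int h.
Proof. by move=> bg bh; rewrite RintegralB//; exact: bmeas_integrable. Qed.

Lemma Rint_scale c g : bmeas g -> Int (fun x => c * g x) = c * Int g.
Proof. by move=> bg; rewrite RintegralZl//; exact: bmeas_integrable. Qed.

Lemma Rint_cst c : Int (fun=> c) = c.
Proof.
rewrite Rintegral_cst// -[RHS]mulr1; congr (_ * _).
by rewrite (_ : 1 = fine 1%E)//; congr fine; exact: probability_setT.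
Qed.

Lemma Rint_le g h : bmeas g -> bmeas h -> (forall x, g x <= h x) -> Int g <= Int h.
Proof. by move=> bg bh gh; apply: le_Rintegral => //; exact: bmeas_integrable. Qed.

Lemma Rint_ae g h : bmeas g -> bmeas h -> {ae mu, forall x, g x = h x} -> Int g = Int h.
Proof.
move=> [mg _] [mh _] gh; congr fine; apply: ae_eq_integral => //.
- exact/measurable_EFinP.
- exact/measurable_EFinP.
- by apply: filterS gh => x /= ->.
Qed.

Lemma Rint_eq0 g : bmeas g -> (forall x, 0 <= g x) -> Int g <= 0 ->
  {ae mu, forall x, g x = 0}.
Proof.
move=> bg g0 Ig.
have mg : measurable_fun setT (EFin \o g) by apply/measurable_EFinP; case: bg.
have I0 : (\int[mu]_(x in setT) `|(EFin \o g) x| = 0)%E.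
  under eq_integral do rewrite /= ger0_norm//.
  rewrite -[LHS]fineK; last exact: integrable_fin_num (bmeas_integrable bg).
  congr EFin; apply/eqP; rewrite eq_le Ig /=; exact: Rintegral_ge0.
have [h _] := ae_eq_integral_abs mu measurableT mg.
by apply: filterS (h I0) => x /(_ Logic.I) [].
Qed.

Lemma Rint_cvg (g_ : nat -> X -> R) g (M : R) : (forall n, measurable_fun setT (g_ n)) ->
  measurable_fun setT g -> (forall n x, `|g_ n x| <= M) ->
  {ae mu, forall x, g_ n x @[n --> \oo] --> g x} ->
  Int (g_ n) @[n --> \oo] --> Int g.
Proof.
move=> mg_ mg gM gg.
have [] := @dominated_convergence _ _ _ mu setT measurableT
  (fun n x => (g_ n x)%:E) (fun x => (g x)%:E) (fun=> M%:E).
- by move=> n; exact/measurable_EFinP.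
- exact/measurable_EFinP.
- by apply: filterS gg => x h _; apply: cvg_EFin => //; exact: nearW.
- exact: bmeas_integrable (bmeas_cst M).
- by apply: aeW => x n _ /=; rewrite lee_fin.
move=> ig _ h; apply: fine_cvg.
rewrite fineK//; exact: integrable_fin_num.
Qed.

(** * Measure-preserving maps *)

Definition mpres S := measurable_fun setT S /\
  forall A, measurable A -> mu (S @^-1` A) = mu A.

Lemma Rint_mpres g S : mpres S -> bmeas g -> Int (fun x => g (S x)) = Int g.
Proof.
move=> [mS muS] bg; congr fine.
have mg : measurable_fun setT (EFin \o g) by apply/measurable_EFinP; case: bg.
have := @integral_pushforward _ _ _ _ R S mS mu setT (EFin \o g) mg.
rewrite preimage_setT => /(_ (bmeas_integrable (bmeas_comp mS bg)) measurableT) <-.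
by apply: eq_measure_integral => A mA _; rewrite -[RHS]muS.
Qed.

Lemma ae_mpres S (P : X -> Prop) : mpres S -> {ae mu, forall x, P x} ->
  {ae mu, forall x, P (S x)}.
Proof.
move=> [mS muS] [N [mN N0 PN]]; exists (S @^-1` N); split.
- by rewrite -[X in measurable X]setTI; exact: mS.
- by rewrite muS.
- by move=> x /= nP; exact: PN.
Qed.

Lemma mpres_id : mpres idfun.
Proof. by split=> //; exact: measurable_id. Qed.

Lemma mpres_comp S S' : mpres S -> mpres S' -> mpres (S \o S').
Proof.
move=> [mS h] [mS' h']; split; first exact: measurableT_comp.
move=> A mA; rewrite comp_preimage h' ?h//.
by rewrite -[X in measurable X]setTI; exact: mS.
Qed.

Lemma mpres_iter S n : mpres S -> mpres (iter n S).
Proof.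
by move=> h; elim: n => [|n IH]; [exact: mpres_id|exact: (mpres_comp h IH)].
Qed.

(** The bound holds everywhere, so pointwise inequalities integrate without null sets; [disc_trunc]
    brings essentially bounded functions into this form. *)
Definition bdisc u := cmeasurable u /\ forall x, abs2 (u x) <= 1.

Definition dist2 u v : R := Int (fun x => abs2 (u x - v x)).

Lemma bdisc_comp u S : measurable_fun setT S -> bdisc u -> bdisc (u \o S).
Proof.
move=> mS [[m1 m2] u1]; split; last by move=> x; exact: u1.
by split; [exact: (measurableT_comp m1 mS)|exact: (measurableT_comp m2 mS)].
Qed.

Lemma bdisc_cmul u v : bdisc u -> bdisc v -> bdisc (fun x => cmul (u x) (v x)).
Proof.
move=> [[u1 u2] uD] [[v1 v2] vD]; split; last first.
  by move=> x; rewrite abs2_cmul mulr_ile1 ?abs2_ge0.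
split.
- by apply: measurable_funB; exact: measurable_funM.
- by apply: measurable_funD; exact: measurable_funM.
Qed.

Lemma bdisc_cconj u : bdisc u -> bdisc (fun x => cconj (u x)).
Proof.
move=> [[u1 u2] uD]; split; last by move=> x; rewrite abs2_cconj.
by split=> //; exact: measurable_funN.
Qed.

Lemma bdisc_cst c : abs2 c <= 1 -> bdisc (fun=> c).
Proof. by move=> c1; split=> //; split; exact: measurable_cst. Qed.

Lemma bdisc_exp (P : X -> R) : measurable_fun setT P ->
  bdisc (fun x => cexp2pi (P x)).
Proof.
move=> mP; split; last by move=> x; rewrite abs2_exp.
have mP2 : measurable_fun setT (fun x => 2 * pi * P x).
  by apply: measurable_funM => //; exact: measurable_cst.
split.
- apply: measurableT_comp mP2; apply: continuous_measurable_fun.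
  exact: continuous_cos.
- apply: measurableT_comp mP2; apply: continuous_measurable_fun.
  exact: continuous_sin.
Qed.

Lemma measurable_carg u : cmeasurable u -> measurable_fun setT (fun x => carg (u x)).
Proof.
move=> [m1 m2].
have ma : measurable_fun setT
    (fun x => acos (Num.max (-1) (Num.min 1 (u x).1)) / (2 * pi)).
  apply: measurable_funM; last exact: measurable_cst.
  apply: (measurableT_comp _ m1 (f := fun t : R => acos (Num.max (-1) (Num.min 1 t)))).
  apply: nonincreasing_measurable => // s t st.
  have clip (r : R) : -1 <= Num.max (-1) (Num.min 1 r) <= 1.
    by rewrite le_max lexx /= ge_max ge_min lexx /= andbT; lra.
  have Cst : Num.max (-1) (Num.min 1 s) <= Num.max (-1) (Num.min 1 t).
    rewrite ge_max; apply/andP; split; first by have /andP[] := clip t.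
    by rewrite le_max; apply/orP; right; rewrite le_min !ge_min lexx st orbT.
  rewrite leNgt; apply/negP => lt.
  have acos_in (r : R) : -1 <= r <= 1 -> acos r \in `[0, pi]%R.
    by move=> r1; rewrite in_itv /= acos_ge0 ?acos_lepi.
  move: lt; rewrite -ltr_cos ?acos_in// !acosK ?in_itv//=.
  by rewrite ltNge Cst.
apply: measurable_fun_ifT => //; last exact: measurable_funN.
exact: measurable_fun_ler.
Qed.

Lemma bmeas_component u : bdisc u -> bmeas (fun x => (u x).1) /\ bmeas (fun x => (u x).2).
Proof.
move=> [[m1 m2] uD].
by split; split=> //; exists 1 => x; have [] := abs2_le1_components (uD x).
Qed.

Lemma bmeas_abs2B u v : bdisc u -> bdisc v -> bmeas (fun x => abs2 (u x - v x)).
Proof.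
move=> /bmeas_component[u1 u2] /bmeas_component[v1 v2].
by apply: bmeasD; apply: bmeas_sqr; exact: bmeasB.
Qed.

Lemma bmeas_abs2 u : bdisc u -> bmeas (fun x => abs2 (u x)).
Proof. by move=> /bmeas_component[u1 u2]; apply: bmeasD; exact: bmeas_sqr. Qed.

Lemma bdisc_abs2 u : bdisc u -> bdisc (fun x => (abs2 (u x), 0)).
Proof.
move=> bu; rewrite (_ : (fun _ => _) = (fun x => cmul (u x) (cconj (u x)))).
  by apply: bdisc_cmul => //; exact: bdisc_cconj.
by apply/funext=> x; rewrite cmul_conj.
Qed.

Lemma bdisc_mid u v : bdisc u -> bdisc v ->
  bdisc (fun x => (((u x).1 + (v x).1) / 2, ((u x).2 + (v x).2) / 2)).
Proof.
move=> [[u1 u2] uD] [[v1 v2] vD]; split.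
  by split; apply: measurable_funM => //; exact: measurable_funD.
move=> x; have := abs2_mid (u x) (v x) 0; rewrite !subr0 => /le_trans; apply.
by rewrite ler_pdivrMr// mulr_natr mulr2n lerD.
Qed.

Lemma dist2_ge0 u v : 0 <= dist2 u v.
Proof. by apply: Rintegral_ge0 => x _; exact: abs2_ge0. Qed.

Lemma dist2C u v : dist2 u v = dist2 v u.
Proof. by rewrite /dist2; under eq_Rintegral do rewrite abs2C. Qed.

Lemma dist2_triangle u v w : bdisc u -> bdisc v -> bdisc w ->
  dist2 u w <= 2 * dist2 u v + 2 * dist2 v w.
Proof.
move=> bu bv bw; have b1 := bmeas_abs2B bu bv; have b2 := bmeas_abs2B bv bw.
rewrite /dist2 -!Rint_scale// -Rint_add ?bmeasZ//; try exact: bmeasZ.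
apply: Rint_le => [||x]; last exact: abs2_triangle.
- exact: bmeas_abs2B.
- by apply: bmeasD; exact: bmeasZ.
Qed.

Lemma dist2_cmul u v u' v' : bdisc u -> bdisc v -> bdisc u' -> bdisc v' ->
  dist2 (fun x => cmul (u x) (v x)) (fun x => cmul (u' x) (v' x)) <=
  2 * dist2 u u' + 2 * dist2 v v'.
Proof.
move=> bu bv bu' bv'; have b1 := bmeas_abs2B bu bu'; have b2 := bmeas_abs2B bv bv'.
rewrite /dist2 -!Rint_scale// -Rint_add ?bmeasZ//; try exact: bmeasZ.
apply: Rint_le => [||x].
- by apply: bmeas_abs2B; exact: bdisc_cmul.
- by apply: bmeasD; exact: bmeasZ.
- by apply: abs2_subM; [exact: bv.2|exact: bu'.2].
Qed.

Lemma dist2_cconj u v :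
  dist2 (fun x => cconj (u x)) (fun x => cconj (v x)) = dist2 u v.
Proof.
by rewrite /dist2; apply: eq_Rintegral => x _; rewrite -cconjB abs2_cconj.
Qed.

Lemma dist2_mpres u v S : mpres S -> bdisc u -> bdisc v ->
  dist2 (u \o S) (v \o S) = dist2 u v.
Proof. by move=> mS bu bv; rewrite /dist2 -(Rint_mpres mS (bmeas_abs2B bu bv)). Qed.

Lemma dist2_ael u u' v : bdisc u -> bdisc u' -> bdisc v ->
  {ae mu, forall x, u x = u' x} -> dist2 u v = dist2 u' v.
Proof.
move=> bu bu' bv uu'; apply: Rint_ae; try exact: bmeas_abs2B.
by apply: filterS uu' => x ->.
Qed.

Lemma dist2_le u v u' v' : bdisc u -> bdisc v -> bdisc u' -> bdisc v' ->
  (forall x, abs2 (u x - v x) <= abs2 (u' x - v' x)) -> dist2 u v <= dist2 u' v'.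
Proof. by move=> *; apply: Rint_le => //; exact: bmeas_abs2B. Qed.

Lemma dist2_eq0 u v : bdisc u -> bdisc v -> dist2 u v <= 0 ->
  {ae mu, forall x, u x = v x}.
Proof.
move=> bu bv /(Rint_eq0 (bmeas_abs2B bu bv)) h.
apply: filterS (h _) => [x /abs2_eq0/subr0_eq//|x]; exact: abs2_ge0.
Qed.

Lemma dist2_cst c c' : dist2 (fun=> c) (fun=> c') = abs2 (c - c').
Proof. exact: Rint_cst. Qed.

Lemma dist2_cmull u v w : bdisc u -> bdisc v -> (forall x, abs2 (w x) <= 1) ->
  cmeasurable w ->
  dist2 (fun x => cmul (w x) (u x)) (fun x => cmul (w x) (v x)) <= dist2 u v.
Proof.
move=> bu bv w1 mw; apply: dist2_le => //; try exact: bdisc_cmul.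
move=> x; rewrite (_ : _ - _ = cmul (w x) (u x - v x)).
  by rewrite abs2_cmul ler_piMl// abs2_ge0.
by rewrite /cmul; apply: injective_projections => /=; ring.
Qed.

(** Nonnegativity of the variance. *)
Lemma sqr_Rint_le g : bmeas g -> (Int g) ^+ 2 <= Int (fun x => g x ^+ 2).
Proof.
move=> bg; set m := Int g; have bg2 := bmeas_sqr bg.
have : 0 <= Int (fun x => g x ^+ 2 - (2 * m * g x - m ^+ 2)).
  apply: Rintegral_ge0 => x _.
  by rewrite (_ : _ - _ = (g x - m) ^+ 2) ?sqr_ge0//; ring.
rewrite Rint_sub ?Rint_sub ?Rint_scale ?Rint_cst//; try exact: bmeas_cst; try exact: bmeasZ.
  by rewrite -/m; nra.
by apply: bmeasB; [exact: bmeasZ|exact: bmeas_cst].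
Qed.

Lemma abs2_cintegral_le u : bdisc u -> abs2 (cintegral mu u) <= Int (fun x => abs2 (u x)).
Proof.
move=> /bmeas_component[b1 b2]; rewrite {1}/abs2 /cintegral /=.
by rewrite /abs2 Rint_add ?lerD ?sqr_Rint_le//; exact: bmeas_sqr.
Qed.

Lemma L1dist_le u v : bdisc u -> bdisc v -> L1dist mu u v <= Num.sqrt (dist2 u v).
Proof.
move=> bu bv; have b2 := bmeas_abs2B bu bv.
have bc : bmeas (fun x => cabs (u x - v x)).
  split; last first.
    have [_ [M hM]] := b2; exists (1 + M) => x; rewrite ger0_norm ?cabs_ge0//.
    have := hM x; rewrite ger0_norm ?abs2_ge0// -sqr_cabs.
    by have := cabs_ge0 (u x - v x); nra.
  apply: measurableT_comp b2.1; apply: continuous_measurable_fun.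
  exact: sqrt_continuous.
rewrite -(ler_pXn2r (_ : 0 < 2)%N) ?nnegrE ?sqrtr_ge0//.
  rewrite sqr_sqrtr ?dist2_ge0//; apply: (le_trans (sqr_Rint_le bc)).
  by rewrite le_eqVlt; apply/orP; left; apply/eqP/eq_Rintegral => x _; exact: sqr_cabs.
by apply: Rintegral_ge0 => x _; exact: cabs_ge0.
Qed.

End BoundedIntegrals.

(** * Polynomials and their rigidity *)

Section Iterates.
Context {d : measure_display} {X : measurableType d} (T W : X -> X).
Hypotheses (TK : cancel T W) (WK : cancel W T).

Lemma TpowS n x : Tpow T W (n + 1) x = T (Tpow T W n x).
Proof.
case: n => [m|[|m]].
- by rewrite -PoszD addn1.
- by have -> : Negz 0 + 1 = 0 by []; rewrite /= WK.
- have -> : Negz m.+1 + 1 = Negz m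
    by rewrite !NegzE -(addn1 m.+1) PoszD opprD addrNK.
  by rewrite [RHS]/= WK.
Qed.

Lemma TpowP n x : Tpow T W (n - 1) x = W (Tpow T W n x).
Proof. by rewrite -[n in RHS](subrK 1) TpowS TK. Qed.

Lemma Tpow_add a b x : Tpow T W (a + b) x = Tpow T W a (Tpow T W b x).
Proof.
elim/int_rect: a => [|n IH|n IH].
- by rewrite add0r.
- by rewrite -addn1 PoszD -addrA (addrC 1 b) addrA !TpowS IH.
- by rewrite -addn1 PoszD opprD addrAC !TpowP IH.
Qed.

Lemma TpowC a b x : Tpow T W a (Tpow T W b x) = Tpow T W b (Tpow T W a x).
Proof. by rewrite -!Tpow_add addrC. Qed.

Lemma Tpow_opp_nat (n : nat) x : Tpow T W (- n%:Z) x = iter n W x.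
Proof. by case: n. Qed.

End Iterates.

(** * Stability properties of polynomials, and phase rigidity *)

Section Polynomials.
Context {R : realType} {d : measure_display} {X : measurableType d}.
Variables (mu : probability X R) (T W : X -> X).
Hypothesis hT : mps mu T W.
Implicit Types (P Q : X -> R) (hs : seq int) (h k : int) (n : nat).

Let TK : cancel T W. Proof. by case: hT. Qed.
Let WK : cancel W T. Proof. by case: hT. Qed.

Lemma mpres_T : mpres mu T.
Proof. by case: hT => *; split. Qed.

Lemma mpres_W : mpres mu W.
Proof.
case: hT => _ _ mT mW muT; split=> // A mA.
rewrite -muT; last by rewrite -[X in measurable X]setTI; exact: mW.
by congr (mu _); apply/funext => x /=; rewrite TK.
Qed.

Lemma mpres_Tpow k : mpres mu (Tpow T W k).
Proof. by case: k => n; apply: mpres_iter; [exact: mpres_T|exact: mpres_W]. Qed.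

Local Notation deltas := (deltas T W).
Local Notation delta := (delta T W).
Local Notation poly := (poly_deg mu T W).

Lemma deltas_comp hs P k :
  deltas hs (fun x => P (Tpow T W k x)) = (fun x => deltas hs P (Tpow T W k x)).
Proof.
elim: hs => //= h hs IH; rewrite IH; apply/funext => x.
by rewrite /Defs.delta (TpowC TK WK).
Qed.

Lemma deltasD hs P Q :
  deltas hs (fun x => P x + Q x) = (fun x => deltas hs P x + deltas hs Q x).
Proof.
elim: hs => //= h hs ->; apply/funext => x; rewrite /Defs.delta; ring.
Qed.

Lemma deltasN hs P : deltas hs (fun x => - P x) = (fun x => - deltas hs P x).
Proof.
elim: hs => //= h hs ->; apply/funext => x; rewrite /Defs.delta; ring.
Qed.

Lemma measurable_delta h P : measurable_fun setT P -> measurable_fun setT (delta h P).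
Proof.
move=> mP; apply: measurable_funB => //.
exact: (measurableT_comp mP (mpres_Tpow _).1).
Qed.

Lemma ae_deltas_int hs P : {ae mu, forall x, P x \is a Num.int} ->
  {ae mu, forall x, deltas hs P x \is a Num.int}.
Proof.
move=> Pint; elim: hs => //= h hs IH.
by apply: filterS2 IH (ae_mpres (mpres_Tpow (- h)) IH) => x ? ?; exact: rpredB.
Qed.

Lemma poly_degD n P Q : poly n P -> poly n Q -> poly n (fun x => P x + Q x).
Proof.
move=> [mP hP] [mQ hQ]; split; first exact: measurable_funD.
move=> hs sz; rewrite deltasD.
by apply: filterS2 (hP hs sz) (hQ hs sz) => x ? ?; exact: rpredD.
Qed.

Lemma poly_degN n P : poly n P -> poly n (fun x => - P x).
Proof.
move=> [mP hP]; split; first exact: measurable_funN.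
by move=> hs sz; rewrite deltasN; apply: filterS (hP hs sz) => x ?; rewrite rpredN.
Qed.

Lemma poly_degB n P Q : poly n P -> poly n Q -> poly n (fun x => P x - Q x).
Proof. by move=> hP hQ; apply: poly_degD => //; exact: poly_degN. Qed.

Lemma poly_deg_comp n P k : poly n P -> poly n (fun x => P (Tpow T W k x)).
Proof.
move=> [mP hP]; split; first exact: (measurableT_comp mP (mpres_Tpow k).1).
move=> hs sz; rewrite deltas_comp.
exact: (ae_mpres (mpres_Tpow k) (hP hs sz)).
Qed.

Lemma poly_deg_int n P : measurable_fun setT P ->
  {ae mu, forall x, P x \is a Num.int} -> poly n P.
Proof. by move=> mP Pint; split=> // hs _; exact: ae_deltas_int. Qed.

(** Being a polynomial depends only on the class in R/Z, not on the chosen real lift. *)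
Lemma poly_deg_eq_mod n P Q : poly n P -> measurable_fun setT Q ->
  {ae mu, forall x, Q x - P x \is a Num.int} -> poly n Q.
Proof.
move=> hP mQ QP.
rewrite (_ : Q = (fun x => P x + (Q x - P x))); last by apply/funext => x; ring.
apply: poly_degD => //; apply: poly_deg_int => //.
by apply: measurable_funB => //; case: hP.
Qed.

Lemma poly_deg_delta n P h : poly n.+1 P -> poly n (delta h P).
Proof.
move=> [mP hP]; split; first exact: measurable_delta.
(* [foldr] applies the last direction first, so appending [h] places [delta h] innermost. *)
move=> hs sz; have := hP (rcons hs h); rewrite size_rcons sz => /(_ erefl).
by rewrite /Defs.deltas foldr_rcons.
Qed.

Lemma poly_deg_of_deltas n P : measurable_fun setT P ->
  (forall h, poly n (delta h P)) -> poly n.+1 P.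
Proof.
move=> mP hP; split=> // hs; case/lastP: hs => // hs h.
rewrite size_rcons => -[sz]; rewrite /Defs.deltas foldr_rcons.
by have [_] := hP h; apply.
Qed.

Lemma poly_deg_cst n (c : R) : poly n (fun=> c).
Proof.
have hd h : delta h (fun=> c) = fun=> 0.
  by apply/funext => x; rewrite /Defs.delta subrr.
have p0 m : poly m (fun=> 0).
  by apply: poly_deg_int; [exact: measurable_cst|apply: aeW => x; exact: rpred0].
case: n => [|n]; last first.
  by apply: poly_deg_of_deltas => [|h]; [exact: measurable_cst|rewrite hd].
split; first exact: measurable_cst.
by move=> [|h []]//= _; rewrite hd; apply: aeW => x; exact: rpred0.
Qed.

(** One direction suffices because the integers are generated by [1]: [delta (h + 1) P] is
    [delta h P] plus a translate of [delta 1 P], and translates and sums keep the degree. *)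
Lemma poly_deg_of_delta1 n P : measurable_fun setT P ->
  poly n (delta 1 P) -> poly n.+1 P.
Proof.
move=> mP hP; apply: poly_deg_of_deltas => //.
have step h : delta (h + 1) P = fun x => delta 1 P (Tpow T W (- h) x) + delta h P x.
  apply/funext => x; rewrite /Defs.delta opprD (addrC _ (-1)).
  by rewrite (Tpow_add TK WK); ring.
elim/int_rect => [|m IH|m IH].
- rewrite (_ : delta 0 P = fun=> 0); first exact: poly_deg_cst.
  by apply/funext => x; rewrite /Defs.delta oppr0 /= subrr.
- rewrite -addn1 PoszD step; apply: poly_degD => //; exact: poly_deg_comp.
- have {}step := step (- (m.+1)%:Z).
  rewrite (_ : delta (- (m.+1)%:Z) P = fun x => delta (- m%:Z) P x -
    delta 1 P (Tpow T W (- - (m.+1)%:Z) x)).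
    by apply: poly_degB => //; exact: poly_deg_comp.
  apply/funext => x; rewrite (_ : - m%:Z = - (m.+1)%:Z + 1) ?step; first by ring.
  by rewrite -addn1 PoszD opprD addrNK.
Qed.

Lemma cexp_delta h P x :
  cexp2pi (delta h P x) = cmul (cexp2pi (P (Tpow T W (- h) x))) (cconj (cexp2pi (P x))).
Proof. by rewrite /Defs.delta cexpB. Qed.

Hypothesis hE : ergodic mu T.

Lemma ergodic_invariant_cst (u : X -> R * R) : bdisc u ->
  {ae mu, forall x, u (W x) = u x} -> exists c, {ae mu, forall x, u x = c}.
Proof.
move=> bu inv; apply: hE; [exact: bu.1| |].
  exact: bmeas_integrable (bmeas_abs2 bu).
by apply: filterS (ae_mpres mpres_T inv) => x /=; rewrite TK.
Qed.

(** The cross term is twice the real part of [conj c] times the mean, so closeness to a constant can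
    be read off the mean. *)
Lemma dist2_cst_expand (u : X -> R * R) (c : R * R) : bdisc u -> abs2 c <= 1 ->
  dist2 mu u (fun=> c) = Rintegral mu setT (fun x => abs2 (u x)) + abs2 c -
    2 * (c.1 * (cintegral mu u).1 + c.2 * (cintegral mu u).2).
Proof.
move=> bu c1; have [b1 b2] := bmeas_component bu.
have b12 : bmeas (fun x => c.1 * (u x).1 + c.2 * (u x).2).
  by apply: bmeasD; exact: bmeasZ.
rewrite /cintegral /= -!Rint_scale// -Rint_add; try exact: bmeasZ.
rewrite -(Rint_scale mu 2 b12) -[in RHS](Rint_cst mu (abs2 c)) -Rint_add;
  [|exact: bmeas_abs2|exact: bmeas_cst].
rewrite -Rint_sub; [|by apply: bmeasD; [exact: bmeas_abs2|exact: bmeas_cst]|exact: bmeasZ].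
apply: eq_Rintegral => x _; rewrite /abs2 /=; ring.
Qed.

Lemma invariant_phase_cst P : measurable_fun setT P ->
  {ae mu, forall x, cexp2pi (P (W x)) = cexp2pi (P x)} ->
  exists th, {ae mu, forall x, cexp2pi (P x) = cexp2pi th}.
Proof.
move=> mP /(ergodic_invariant_cst (bdisc_exp mP))[c hc].
have c1 : abs2 c = 1.
  rewrite -(Rint_cst mu (abs2 c)) -(Rint_cst mu 1); apply: Rint_ae; try exact: bmeas_cst.
  by apply: filterS hc => x <-; rewrite abs2_exp.
by exists (carg c); apply: filterS hc => x; rewrite (cargK c1).
Qed.

(* An eigenfunction with nonzero mean has eigenvalue 1. *)
Lemma phase_rigidity n P (c : R * R) : poly n P -> abs2 c = 1 ->
  dist2 mu (fun x => cexp2pi (P x)) (fun=> c) <= (4 ^+ n)^-1 ->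
  exists th, {ae mu, forall x, cexp2pi (P x) = cexp2pi th}.
Proof.
elim: n P c => [|n IH] P c hP c1 hd; have mP := hP.1.
  apply: invariant_phase_cst => //; have [_ /(_ [:: 1] erefl)] := hP.
  by apply: filterS => x /= /cexp_eq.
set u := fun x => cexp2pi (P x).
have bu : bdisc u := bdisc_exp mP.
have bW : bdisc (u \o W) := bdisc_comp (mpres_W).1 bu.
have hQ := poly_deg_delta 1 hP; set Q := delta 1 P in hQ.
have bcst (z : R * R) : abs2 z = 1 -> @bdisc R _ X (fun=> z).
  by move=> z1; apply: bdisc_cst; rewrite z1.
have eQ : (fun x => cexp2pi (Q x)) = fun x => cmul (u (W x)) (cconj (u x)).
  by apply/funext => x; rewrite cexp_delta.
(* Differentiating multiplies the squared distance by at most [4] and replaces [c] by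
   [c * conj c = 1]; this is the origin of the threshold [4^-n]. *)
have [th hth] : exists th, {ae mu, forall x, cexp2pi (Q x) = cexp2pi th}.
  apply: (IH Q (1, 0)) => //; first exact: abs2_1.
  rewrite eQ (_ : (fun=> (1, 0)) = fun x : X => cmul c (cconj c)); last first.
    by rewrite cmul_conj c1.
  have := dist2_cmul mu bW (bdisc_cconj bu) (bcst _ c1) (bdisc_cconj (bcst _ c1)).
  move=> /le_trans; apply.
  rewrite (dist2_cconj mu u (fun=> c)) (dist2_mpres mpres_W bu (bcst _ c1)).
  by move: hd; rewrite exprS invfM -/u => hd; lra.
have eig : {ae mu, forall x, u (W x) = cmul (cexp2pi th) (u x)}.
  apply: filterS hth => x; move/(congr1 (fun f => f x)): eQ => /= -> <-.
  by rewrite -cmulA (cmulC (cconj _)) cmul_conj abs2_exp cmulz1.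
set m := cintegral mu u.
have m_eig : m = cmul (cexp2pi th) m.
  have [b1 b2] := bmeas_component bu.
  have [bW1 bW2] := bmeas_component bW.
  rewrite [LHS](_ : m = cintegral mu (u \o W)); last first.
    by rewrite /m /cintegral /= (Rint_mpres mpres_W b1) (Rint_mpres mpres_W b2).
  rewrite /m /cmul /cintegral -!Rint_scale// -Rint_sub; try exact: bmeasZ.
  rewrite -Rint_add; try exact: bmeasZ.
  congr pair; apply: Rint_ae => //.
  - by apply: bmeasB; exact: bmeasZ.
  - by apply: filterS eig => x h; exact: (congr1 fst h).
  - by apply: bmeasD; exact: bmeasZ.
  - by apply: filterS eig => x h; exact: (congr1 snd h).
(* With zero mean the squared distance to a unimodular constant would be [2], above the
   threshold. *)
have m0 : m != 0.
  apply/negP => /eqP m0; move: hd.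
  rewrite dist2_cst_expand ?c1// -/u -/m m0 /= !mulr0 addr0 mulr0 subr0.
  under eq_Rintegral do rewrite /u abs2_exp.
  rewrite Rint_cst; apply/negP; rewrite -ltNge (@le_lt_trans _ _ 1)//; last by lra.
  by rewrite invf_le1 ?exprn_gt0// exprn_ege1//; lra.
have th1 : cexp2pi th = (1, 0).
  have : cmul (cexp2pi th - (1, 0)) m = 0.
    apply/eqP; rewrite -[cmul _ _](addrK m) subr_eq0; apply/eqP.
    rewrite [X in _ = X]m_eig.
    rewrite /cmul; apply: injective_projections => /=; ring.
  move=> /(congr1 abs2); rewrite abs2_cmul [X in _ = X](_ : _ = 0); last first.
    by rewrite /abs2 /= expr0n /= addr0.
  move=> /eqP; rewrite mulf_eq0 => /orP[/eqP/abs2_eq0/subr0_eq//|/eqP/abs2_eq0].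
  by move/eqP; rewrite (negbTE m0).
by apply: invariant_phase_cst => //; apply: filterS eig => x; rewrite /u => ->; rewrite th1 cmul1z.
Qed.

End Polynomials.

(** * Almost invariant functions *)

Section FastLimits.
Context {R : realType}.

Lemma geometric_increments_cvg (a : nat -> R) (M : R) :
  (forall n, `|a n.+1 - a n| <= M * 2^-1 ^+ n) -> cvgn a.
Proof.
move=> aM; rewrite (_ : a = fun n => a 0%N + series (telescope a) n); last first.
  by apply/funext => n; exact: eq_sum_telescope.
apply: is_cvgD; first exact: is_cvg_cst.
apply: normed_cvg; apply: (@series_le_cvg _ _ (geometric M 2^-1)).
- by move=> n; exact: normr_ge0.
- by move=> n; exact: le_trans (aM n).
- by move=> n; exact: aM.
- by apply: is_cvg_geometric_series; rewrite ger0_norm; lra.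
Qed.

Definition ccvg (a : nat -> R * R) (l : R * R) :=
  (a n).1 @[n --> \oo] --> l.1 /\ (a n).2 @[n --> \oo] --> l.2.

Lemma ccvg_cst (l : R * R) : ccvg (fun=> l) l.
Proof. by split; exact: cvg_cst. Qed.

Lemma ccvgB a b l l' : ccvg a l -> ccvg b l' -> ccvg (fun n => a n - b n) (l - l').
Proof. by move=> [a1 a2] [b1 b2]; split; exact: cvgB. Qed.

Lemma ccvg_cmul a b l l' : ccvg a l -> ccvg b l' ->
  ccvg (fun n => cmul (a n) (b n)) (cmul l l').
Proof.
move=> [a1 a2] [b1 b2]; split.
- by apply: cvgB; exact: cvgM.
- by apply: cvgD; exact: cvgM.
Qed.

Lemma ccvg_abs2 a l : ccvg a l -> abs2 (a n) @[n --> \oo] --> abs2 l.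
Proof. by move=> [a1 a2]; rewrite /abs2; apply: cvgD; exact: cvgM. Qed.

(** Cutting to [0] keeps measurability immediate, and it is applied to functions already in the disc
    almost everywhere. *)
Definition disc_trunc (z : R * R) : R * R := if abs2 z <= 1 then z else 0.

Lemma disc_trunc_id z : abs2 z <= 1 -> disc_trunc z = z.
Proof. by rewrite /disc_trunc => ->. Qed.

End FastLimits.

(** * Mean-square limits and minimal-norm invariant functions *)

Section AlmostInvariant.
Context {R : realType} {d : measure_display} {X : measurableType d}.
Variable mu : probability X R.
Implicit Types (u v f : X -> R * R).

Lemma bdisc_trunc u : cmeasurable u -> bdisc (fun x => disc_trunc (u x)).
Proof.
move=> [m1 m2]; split; last first.
  by move=> x; rewrite /disc_trunc; case: ifP => // _; rewrite /abs2 /= expr0n /= addr0.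
have mb : measurable_fun setT (fun x => abs2 (u x) <= 1).
  apply: measurable_fun_ler => //.
  by apply: measurable_funD; exact: measurable_funX.
split.
- rewrite (_ : (fun _ => _) = fun x => if abs2 (u x) <= 1 then (u x).1 else 0).
    exact: measurable_fun_ifT.
  by apply/funext => x; rewrite /disc_trunc; case: ifP.
- rewrite (_ : (fun _ => _) = fun x => if abs2 (u x) <= 1 then (u x).2 else 0).
    exact: measurable_fun_ifT.
  by apply/funext => x; rewrite /disc_trunc; case: ifP.
Qed.

(** By monotone convergence the sum of all [g n] has finite integral, hence is finite almost
    everywhere, and it dominates each term. *)
Lemma ae_bounded_weighted_sum (g : nat -> X -> R) (C : R) :
  (forall n, bmeas (g n)) -> (forall n x, 0 <= g n x) ->
  (forall n, Rintegral mu setT (g n) <= C * 2^-1 ^+ n) ->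
  {ae mu, forall x, exists M, forall n, g n x <= M}.
Proof.
move=> bg g0 gC.
pose G x := (\sum_(0 <= n <oo | n \in xpredT) (g n x)%:E)%E.
have mG : measurable_fun setT G.
  apply: ge0_emeasurable_sum => [n x _ _|n _]; first by rewrite lee_fin.
  by apply/measurable_EFinP; case: (bg n).
have C0 : 0 <= C.
  have := gC 0%N; rewrite expr0 mulr1; apply: le_trans.
  by apply: Rintegral_ge0 => x _.
have G0 x : (0 <= G x)%E by apply: nneseries_ge0 => n _ _; rewrite lee_fin.
have iG : (\int[mu]_x G x <= (2 * C)%:E)%E.
  rewrite /G integral_nneseries//; first last.
  - by move=> n x _; rewrite lee_fin.
  - by move=> n; apply/measurable_EFinP; case: (bg n).
  apply: lime_le.
    by apply: is_cvg_nneseries => n _ _; apply: integral_ge0 => x _; rewrite lee_fin.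
  apply: nearW => N; rewrite (@le_trans _ _ (\sum_(0 <= n < N) (C * 2^-1 ^+ n)%:E)%E)//.
    apply: lee_sum => n _.
    have fi : (\int[mu]_x (g n x)%:E)%E \is a fin_num.
      exact: integrable_fin_num (bmeas_integrable mu (bg n)).
    by rewrite -(fineK fi) lee_fin; exact: gC.
  rewrite sumEFin lee_fin -mulr_sumr mulrC ler_wpM2r//.
  suff -> : \sum_(0 <= i < N) 2^-1 ^+ i = 2 - 2 * 2^-1 ^+ N :> R.
    by rewrite gerBl mulr_ge0// exprn_ge0//; lra.
  elim: N => [|N IH]; first by rewrite big_nil expr0; lra.
  by rewrite big_nat_recr//= IH exprS; lra.
have intG : mu.-integrable setT G.
  apply/integrableP; split=> //.
  under eq_integral do rewrite gee0_abs//.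
  exact: le_lt_trans iG (ltry _).
have := integrable_ae measurableT intG; apply: filterS => x /(_ Logic.I) Gx.
exists (fine (G x)) => n; rewrite -lee_fin fineK//.
apply: le_trans (nneseries_lim_ge n.+1 _); last by move=> k _ _; rewrite lee_fin.
rewrite big_mkcond big_nat_recr//= leeDr// sume_ge0// => k _.
by rewrite lee_fin.
Qed.

(** The rate [16^-n] is split: the functions [8^n |u (n+1) - u n|^2] still have integrals summing to
    a finite value, so almost everywhere they are bounded in [n], and the increments then decay at
    least like [2^-n]. *)
Lemma fast_cauchy_limit (u : nat -> X -> R * R) (C : R) :
  (forall n, bdisc (u n)) ->
  (forall n, dist2 mu (u n.+1) (u n) <= C * 16^-1 ^+ n) ->
  exists F, bdisc F /\ {ae mu, forall x, ccvg (u ^~ x) (F x)}.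
Proof.
move=> bu uC.
have bg n : bmeas (fun x => 8 ^+ n * abs2 (u n.+1 x - u n x)).
  by apply: bmeasZ; exact: bmeas_abs2B.
have aeM := @ae_bounded_weighted_sum (fun n x => 8 ^+ n * abs2 (u n.+1 x - u n x)) C bg.
have {}aeM : {ae mu, forall x, exists M, forall n, 8 ^+ n * abs2 (u n.+1 x - u n x) <= M}.
  apply: aeM => [n x|n]; first by rewrite mulr_ge0 ?exprn_ge0 ?abs2_ge0.
  rewrite Rint_scale; last exact: bmeas_abs2B.
  have -> : C * 2^-1 ^+ n = 8 ^+ n * (C * 16^-1 ^+ n).
    rewrite mulrCA -exprMn; congr (_ * _ ^+ _); lra.
  by rewrite ler_wpM2l ?exprn_ge0//; exact: uC.
(* Upper limits are measurable without any knowledge of convergence, and they are the limits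
   wherever the sequence converges. *)
pose G x := (limn_sup (fun n => (u n x).1), limn_sup (fun n => (u n x).2)).
have mG : cmeasurable G.
  have bd x n : -1 <= (u n x).1 <= 1 /\ -1 <= (u n x).2 <= 1.
    by have := abs2_le1_components ((bu n).2 x); rewrite !ler_norml.
  split; apply: measurable_fun_limn_sup => [x _|x _|n].
  - by exists 1 => _ [n _ <-]; have [/andP[]] := bd x n.
  - by exists (-1) => _ [n _ <-]; have [/andP[]] := bd x n.
  - by have [[]] := bu n.
  - by exists 1 => _ [n _ <-]; have [_ /andP[]] := bd x n.
  - by exists (-1) => _ [n _ <-]; have [_ /andP[]] := bd x n.
  - by have [[]] := bu n.
exists (fun x => disc_trunc (G x)); split; first exact: bdisc_trunc.
apply: filterS aeM => x [M hM].
have inc n : abs2 (u n.+1 x - u n x) <= (Num.sqrt M * 2^-1 ^+ n) ^+ 2.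
  have M0 : 0 <= M by apply: le_trans (hM 0%N); rewrite mulr_ge0 ?abs2_ge0.
  rewrite exprMn sqr_sqrtr// -exprM mulnC exprM.
  have h8 : 0 < 8 ^+ n :> R by rewrite exprn_gt0.
  have := hM n; rewrite mulrC -ler_pdivlMr// => /le_trans; apply.
  rewrite ler_wpM2l// -exprVn; apply: lerXn2r; rewrite ?nnegrE; lra.
have cv (p : R * R -> R) : (forall n, p (u n.+1 x) - p (u n x) = p (u n.+1 x - u n x)) ->
    (forall z, p z ^+ 2 <= abs2 z) -> cvgn (fun n => p (u n x)).
  move=> pB pabs; apply: (@geometric_increments_cvg _ _ (Num.sqrt M)) => n.
  have h0 : 0 <= Num.sqrt M * 2^-1 ^+ n.
    by rewrite mulr_ge0 ?sqrtr_ge0 ?exprn_ge0//; lra.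
  rewrite -(ler_pXn2r (_ : 0 < 2)%N) ?nnegrE// -normrX ger0_norm ?sqr_ge0// pB.
  exact: le_trans (pabs _) (inc n).
have c1 : cvgn (fun n => (u n x).1).
  by apply: (cv fst) => // z; rewrite /abs2 lerDl sqr_ge0.
have c2 : cvgn (fun n => (u n x).2).
  by apply: (cv snd) => // z; rewrite /abs2 lerDr sqr_ge0.
have cG : ccvg (u ^~ x) (G x).
  by split; rewrite /= cvg_limn_supE.
rewrite disc_trunc_id//.
have lim1 : (fun=> 1 : R) n @[n --> \oo] --> (1 : R) by exact: cvg_cst.
apply: (ler_cvg_to (ccvg_abs2 cG) lim1).
by apply: nearW => n; exact: (bu n).2.
Qed.

Variables (W : X -> X) (rho : X -> R * R).
Hypotheses (mW : mpres mu W) (mrho : cmeasurable rho)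
  (rho1 : forall x, abs2 (rho x) = 1).

Definition twist u : X -> R * R := fun x => cmul (rho x) (u (W x)).

Let brho : bdisc rho. Proof. by split=> // x; rewrite rho1. Qed.

Lemma bdisc_twist u : bdisc u -> bdisc (twist u).
Proof. by move=> bu; apply: bdisc_cmul => //; exact: bdisc_comp mW.1 bu. Qed.

Lemma bdisc_iter_twist h u : bdisc u -> bdisc (iter h twist u).
Proof. by move=> bu; elim: h => //= h; exact: bdisc_twist. Qed.

Let mid u v : X -> R * R :=
  fun x => (((u x).1 + (v x).1) / 2, ((u x).2 + (v x).2) / 2).

Lemma iter_twist_mid h u v :
  iter h twist (mid u v) = mid (iter h twist u) (iter h twist v).
Proof.
elim: h => //= h ->; apply/funext => x.
by rewrite /twist /mid /cmul; congr pair => /=; ring.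
Qed.

(* The minimal-norm element of the convex set of functions whose twisted orbit
   stays close to [f] is invariant. *)
Lemma almost_invariant f (eta : R) : bdisc f ->
  (forall h, dist2 mu (iter h twist f) f <= eta) ->
  exists F, [/\ bdisc F, {ae mu, forall x, twist F x = F x} & dist2 mu F f <= eta].
Proof.
move=> bf hf.
pose K u := bdisc u /\ forall h, dist2 mu (iter h twist u) f <= eta.
pose N u := Rintegral mu setT (fun x => abs2 (u x)).
have Ktwist u : K u -> K (twist u).
  by move=> [bu hu]; split; [exact: bdisc_twist|move=> h; rewrite -iterSr].
have Kmid u v : K u -> K v -> K (mid u v).
  move=> [bu hu] [bv hv]; split; first exact: bdisc_mid.
  move=> h; rewrite iter_twist_mid.
  have b1 := bmeas_abs2B (bdisc_iter_twist h bu) bf.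
  have b2 := bmeas_abs2B (bdisc_iter_twist h bv) bf.
  apply: (@le_trans _ _ (2^-1 * (dist2 mu (iter h twist u) f + dist2 mu (iter h twist v) f))).
    rewrite /dist2 -Rint_add// -Rint_scale; last exact: bmeasD.
    apply: Rint_le => [||x].
    - by apply: bmeas_abs2B => //; apply: bdisc_mid; exact: bdisc_iter_twist.
    - by apply: bmeasZ; exact: bmeasD.
    - by rewrite mulrC; exact: abs2_mid.
  by have := hu h; have := hv h; lra.
have Ntwist u : bdisc u -> N (twist u) = N u.
  move=> bu; rewrite /N -(Rint_mpres mW (bmeas_abs2 bu)); apply: eq_Rintegral => x _.
  by rewrite abs2_cmul rho1 mul1r.
pose A := [set N u | u in K].
have infA : has_inf A.
  split; first by exists (N f), f.
  by exists 0 => _ [u _ <-]; apply: Rintegral_ge0 => x _; exact: abs2_ge0.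
have mN u : K u -> inf A <= N u.
  by move=> Ku; apply: inf_lbound; [exact: infA.2|exists u].
(* The midpoint stays in [K], so its norm is at least the infimum; the parallelogram law then brings
   nearly minimal elements close together. *)
have para u v : K u -> K v ->
    dist2 mu u v <= 2 * (N u - inf A) + 2 * (N v - inf A).
  move=> Ku Kv; have := mN _ (Kmid _ _ Ku Kv).
  have [bu bv] := (Ku.1, Kv.1).
  have [nu nv] := (bmeas_abs2 bu, bmeas_abs2 bv).
  have nm := bmeas_abs2 (bdisc_mid bu bv).
  suff -> : dist2 mu u v = 2 * N u + 2 * N v - 4 * N (mid u v) by lra.
  rewrite /N -!Rint_scale// -Rint_add; try exact: bmeasZ.
  rewrite -Rint_sub; [|by apply: bmeasD; exact: bmeasZ|exact: bmeasZ].
  by apply: eq_Rintegral => x _; exact: abs2_parallelogram.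
(* Minimality up to [16^-n] gives, through [para], the rate required by [fast_cauchy_limit] with
   constant [4]. *)
have e16 n : 0 < 16^-1 ^+ n :> R by rewrite exprn_gt0// invr_gt0 ltr0n.
have exu n : exists u, K u /\ N u - inf A <= 16^-1 ^+ n.
  have [_ [u Ku <-] lt] := inf_adherent (e16 n) infA.
  by exists u; split=> //; lra.
have [u hu] := choice exu.
have bu n : bdisc (u n) by case: (hu n) => -[].
have [F [bF uF]] : exists F, bdisc F /\ {ae mu, forall x, ccvg (u ^~ x) (F x)}.
  apply: (@fast_cauchy_limit u 4) => // n.
  apply: (le_trans (para _ _ (hu n.+1).1 (hu n).1)).
  have := (hu n.+1).2; have := (hu n).2; have := e16 n.
  by rewrite exprS; move: (_ ^+ n) => e; lra.
have bnd v w x : bdisc v -> bdisc w -> `|abs2 (v x - w x)| <= 4.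
  move=> bv bw; rewrite ger0_norm ?abs2_ge0//.
  have := abs2_triangle (v x) 0 (w x); have := bv.2 x; have := bw.2 x.
  by rewrite sub0r subr0 (_ : abs2 (- w x) = abs2 (w x)); [lra|rewrite /abs2 /= !sqrrN].
exists F; split=> //.
- apply: dist2_eq0 => //; first exact: bdisc_twist.
  (* [twist (u n)] lies in [K] and has the norm of [u n], so the two are within [4 * 16^-n];
     dominated convergence carries this to [F]. *)
  have lim : dist2 mu (twist (u n)) (u n) @[n --> \oo] --> dist2 mu (twist F) F.
    apply: (@Rint_cvg _ _ _ _ _ _ 4).
    - by move=> n; case: (bmeas_abs2B (bdisc_twist (bu n)) (bu n)).
    - by case: (bmeas_abs2B (bdisc_twist bF) bF).
    - by move=> n x; apply: bnd => //; exact: bdisc_twist.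
    - apply: filterS2 uF (ae_mpres mW uF) => x h1 h2.
      apply: ccvg_abs2; apply: ccvgB => //; apply: ccvg_cmul => //; exact: ccvg_cst.
  have lim0 : 4 * 16^-1 ^+ n @[n --> \oo] --> (0 : R).
    by apply: (@cvg_geometric _ 4 16^-1); rewrite ger0_norm; lra.
  apply: (ler_cvg_to lim lim0); apply: nearW => n.
  have [Kn hn] := hu n.
  apply: (le_trans (para _ _ (Ktwist _ Kn) Kn)); rewrite Ntwist//.
  by move: hn; move: (_ ^+ n) => e; lra.
- have lim : dist2 mu (u n) f @[n --> \oo] --> dist2 mu F f.
    apply: (@Rint_cvg _ _ _ _ _ _ 4).
    - by move=> n; case: (bmeas_abs2B (bu n) bf).
    - by case: (bmeas_abs2B bF bf).
    - by move=> n x; exact: bnd.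
    - apply: filterS uF => x h1.
      by apply: ccvg_abs2; apply: ccvgB => //; exact: ccvg_cst.
  apply: (ler_cvg_to lim (@cvg_cst _ eta _ _ _)); apply: nearW => n.
  by have [[_ /(_ 0%N)]] := hu n.
Qed.

End AlmostInvariant.

(** * Gowers-Host-Kra seminorms *)

Section Averages.
Context {R : realType}.
Implicit Types (a : nat -> R) (e : R).

(* A divergent sequence has the junk limit [point = 0]. *)
Lemma dvg_limn0 a : ~ cvgn a -> limn a = 0.
Proof. by move=> /dvgP ->. Qed.

Lemma limn_itv01 a : (forall n, 0 <= a n <= 1) -> 0 <= limn a <= 1.
Proof.
move=> a01; have [ca|/dvg_limn0 ->] := pselect (cvgn a); last by rewrite lexx ler01.
by apply/andP; split; [apply: limr_ge|apply: limr_le] => //;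
  apply: nearW => n; have /andP[] := a01 n.
Qed.

Lemma average_itv01 a H : (forall h, 0 <= a h <= 1) ->
  0 <= H%:R^-1 * \sum_(1 <= h < H.+1) a h <= 1.
Proof.
move=> a01; case: H => [|H]; first by rewrite invr0 mul0r lexx ler01.
have s0 : 0 <= \sum_(1 <= h < H.+2) a h by apply: sumr_ge0 => h _; have /andP[] := a01 h.
have s1 : \sum_(1 <= h < H.+2) a h <= H.+1%:R.
  rewrite (@le_trans _ _ (\sum_(1 <= h < H.+2) 1))//.
    by apply: ler_sum => h _; have /andP[] := a01 h.
  by rewrite sumr_const_nat subSS subn0.
by rewrite mulr_ge0 ?invr_ge0//= mulrC ler_pdivrMr ?ltr0n// mul1r.
Qed.

Lemma powR_itv01 (x p : R) : 0 <= p -> 0 <= x <= 1 -> 0 <= x `^ p <= 1.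
Proof.
move=> p0 /andP[x0 x1]; rewrite powR_ge0 /=.
have : x `^ p <= 1 `^ p by apply: ge0_ler_powR; rewrite ?nnegrE.
by rewrite powR1.
Qed.

Lemma bernoulli_le (x : R) q : 0 <= x <= 1 -> 1 - q%:R * x <= (1 - x) ^+ q.
Proof.
move=> /andP[x0 x1]; elim: q => [|q IH]; first by rewrite mul0r expr0; lra.
rewrite exprS -natr1; have : (1 - x) * (1 - q%:R * x) <= (1 - x) * (1 - x) ^+ q.
  by rewrite ler_wpM2l//; lra.
have : 0 <= q%:R :> R by [].
move: (q%:R) (_ ^+ q) => Q E; nra.
Qed.

(** A limit of at least [1/2] is not the junk value [0], so the sequence converges and its terms
    eventually exceed [1 - 2 e]. Undoing the root costs a factor [q] by Bernoulli's inequality, and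
    [a^k <= a] on [[0, 1]]. *)
Lemma lim_root_average_large a (k q : nat) e : (forall h, 0 <= a h <= 1) ->
  (0 < k)%N -> (0 < q)%N -> 0 < e <= 2^-1 ->
  1 - e <= limn (fun H : nat =>
    (H%:R^-1 * \sum_(1 <= h < H.+1) a h ^+ k) `^ (q%:R)^-1) ->
  exists N, forall H, (N <= H)%N ->
    (1 - 2 * q%:R * e) * H%:R <= \sum_(1 <= h < H.+1) a h.
Proof.
move=> a01 k0 q0 /andP[e0 e2]; set v := fun H : nat => _ `^ _ => hv.
have cv : cvgn v.
  by apply: contrapT => /dvg_limn0 v0; move: hv; rewrite v0; lra.
have : 1 - 2 * e < limn v by lra.
move=> /(cvgr_gt _ cv) [N _ hN].
exists (maxn N 1) => H; rewrite geq_max => /andP[NH H0].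
have {}hN := ltW (hN H NH).
set A := H%:R^-1 * \sum_(1 <= h < H.+1) a h ^+ k.
have ak01 h : 0 <= a h ^+ k <= 1.
  by have /andP[? ?] := a01 h; rewrite exprn_ge0 ?exprn_ile1.
have A0 : 0 <= A by have /andP[] := average_itv01 H ak01.
have vq : v H ^+ q = A.
  rewrite /v -/A -powR_mulrn ?powR_ge0// -powRrM mulVf ?powRr1//.
  by rewrite pnatr_eq0 -lt0n.
have : 1 - q%:R * (2 * e) <= A.
  rewrite -vq; apply: le_trans (bernoulli_le _ _) _; first by lra.
  by apply: lerXn2r => //; rewrite nnegrE; lra.
have Hpos : 0 < H%:R :> R by rewrite ltr0n.
move=> hA; apply: (@le_trans _ _ (\sum_(1 <= h < H.+1) a h ^+ k)).
  rewrite (_ : \sum_(1 <= h < H.+1) a h ^+ k = A * H%:R).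
    by rewrite ler_wpM2r//; lra.
  by rewrite /A mulrAC mulVf ?mul1r// gt_eqF.
apply: ler_sum => h _; have /andP[? ?] := a01 h.
by case: (k) k0 => // k' _; rewrite exprS ler_piMr ?exprn_ile1.
Qed.

(** If no [m] worked, then [a m + a (m + h) <= 2 - e] for every [m]. Summed over a window [H > h],
    this contradicts averages of at least [1 - k]: the total loss is at most [3 k H], which is less
    than [e H]. *)
Lemma large_average_pairs a (k e : R) N : (forall h, 0 <= a h <= 1) ->
  0 < e -> 0 <= k <= e / 4 ->
  (forall H, (N <= H)%N -> (1 - k) * H%:R <= \sum_(1 <= h < H.+1) a h) ->
  forall h, exists m, 1 - e <= a m /\ 1 - e <= a (m + h)%N.
Proof.
move=> a01 e0 /andP[k0 ke] hN h; apply: contrapT => hno.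
have no m : a m + a (m + h)%N <= 2 - e.
  have /andP[? ?] := a01 m; have /andP[? ?] := a01 (m + h)%N.
  apply: contrapT => /negP; rewrite -ltNge => lt; apply: hno; exists m.
  by split; lra.
pose H := maxn N h.+1.
have NH : (N <= H)%N by rewrite leq_maxl.
have hH : (h < H)%N by rewrite leq_maxr.
have h1 := hN H NH; have h2 := hN (H + h)%N (leq_trans NH (leq_addr _ _)).
have : \sum_(1 <= m < H.+1) (a m + a (m + h)%N) <= (2 - e) * H%:R.
  rewrite (@le_trans _ _ (\sum_(1 <= m < H.+1) (2 - e)))//.
    by apply: ler_sum => m _.
  by rewrite sumr_const_nat subSS subn0 mulr_natr.
rewrite big_split /=.
have -> : \sum_(1 <= m < H.+1) a (m + h)%N = \sum_(h.+1 <= m < (H + h).+1) a m.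
  by rewrite -[h.+1]add1n big_addn -addSn addnK.
have hs : \sum_(1 <= m < (H + h).+1) a m <=
    h%:R + \sum_(h.+1 <= m < (H + h).+1) a m.
  rewrite (@big_cat_nat _ _ _ h.+1)//=; last by rewrite ltnS leq_addl.
  rewrite lerD2r (@le_trans _ _ (\sum_(1 <= m < h.+1) 1))//.
    by apply: ler_sum => m _; have /andP[] := a01 m.
  by rewrite sumr_const_nat subSS subn0.
move=> h3; have : h%:R <= H%:R :> R by rewrite ler_nat ltnW.
have : 0 < H%:R :> R by rewrite ltr0n (leq_trans _ hH).
move: h1 h2 h3 hs => + + + + H0 hH'; rewrite natrD; move: H0 hH'.
move: (\sum_(1 <= m < H.+1) a m) (\sum_(1 <= m < _) a m)
  (\sum_(h.+1 <= m < _) a m) (H%:R) (h%:R) => S1 S2 S3 h' H'.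
nra.
Qed.

End Averages.

(** * Multiplicative derivatives and their seminorms *)

Section GowersBasics.
Context {R : realType} {d : measure_display} {X : measurableType d}.
Variables (mu : probability X R) (T W : X -> X).
Hypothesis hT : mps mu T W.
Implicit Types (f g : X -> R * R) (P : X -> R) (n h : nat).

Local Notation G := (gowers_aux mu T W).

(** The multiplicative derivative [T^h f * conj f]; since [T^h f = f o T^-h], it involves the
    iterates of [W]. *)
Definition dermul h f : X -> R * R :=
  fun x => cmul (f (iter h W x)) (cconj (f x)).

Lemma gowers_auxS n f : G n.+1 f =
  limn (fun H : nat => (H%:R^-1 * \sum_(1 <= h < H.+1)
    G n (dermul h f) ^+ (2 ^ n.+1)%N) `^ ((2 ^ n.+2)%N%:R)^-1).
Proof.
rewrite /=; congr (limn _); apply/funext => H; congr ((_ * _) `^ _).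
apply: eq_bigr => h _; congr (G n _ ^+ _); apply/funext => x.
by rewrite /shiftf Tpow_opp_nat.
Qed.

Lemma mpres_iterW h : mpres mu (iter h W).
Proof. exact: mpres_iter (mpres_W hT). Qed.

Lemma cmeasurable_dermul h f : cmeasurable f -> cmeasurable (dermul h f).
Proof.
move=> [m1 m2].
have m1h := measurableT_comp m1 (mpres_iterW h).1.
have m2h := measurableT_comp m2 (mpres_iterW h).1.
have m2N := measurable_funN m2.
split.
- by apply: measurable_funB; exact: measurable_funM.
- by apply: measurable_funD; exact: measurable_funM.
Qed.

Lemma bdisc_dermul h f : bdisc f -> bdisc (dermul h f).
Proof.
move=> bf; apply: bdisc_cmul; last exact: bdisc_cconj.
exact: bdisc_comp (mpres_iterW h).1 bf.
Qed.

Lemma gowers_aux_ae n f g : cmeasurable f -> cmeasurable g ->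
  {ae mu, forall x, f x = g x} -> G n f = G n g.
Proof.
elim: n f g => [|n IH] f g mf mg fg.
  congr cabs; rewrite /cintegral; congr pair; congr fine; apply: ae_eq_integral => //;
    try (apply/measurable_EFinP; by case: mf mg => ? ? []);
    by apply: filterS fg => x /= ->.
rewrite !gowers_auxS; congr (limn _); apply/funext => H; congr ((_ * _) `^ _).
apply: eq_bigr => h _; congr (_ ^+ _); apply: IH; try exact: cmeasurable_dermul.
by apply: filterS2 fg (ae_mpres (mpres_iterW h) fg) => x e1 e2; rewrite /dermul e1 e2.
Qed.

Lemma gowers_aux_itv01 n f : bdisc f -> 0 <= G n f <= 1.
Proof.
elim: n f => [|n IH] f bf.
  rewrite cabs_ge0 cabs_le1 (le_trans (abs2_cintegral_le _ bf))//.
  rewrite -[leRHS](Rint_cst mu 1); apply: Rint_le; [exact: bmeas_abs2|exact: bmeas_cst|].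
  by case: bf.
rewrite gowers_auxS; apply: limn_itv01 => H; apply: powR_itv01; first by rewrite invr_ge0.
apply: average_itv01 => h; have /andP[? ?] := IH _ (bdisc_dermul h bf).
by rewrite exprn_ge0 ?exprn_ile1.
Qed.

(** The factor [8 q], with [q = 2^(n+2)] the order of the root, turns the loss [2 q e'] of
    [lim_root_average_large] into the [e / 4] that [large_average_pairs] allows. *)
Lemma gowers_aux_pairs n (e e' : R) f : 0 < e -> 0 < e' <= 2^-1 ->
  8 * (2 ^ n.+2)%N%:R * e' <= e -> bdisc f -> 1 - e' <= G n.+1 f ->
  forall h, exists m, 1 - e <= G n (dermul m f) /\ 1 - e <= G n (dermul (m + h)%N f).
Proof.
move=> e0 e'2 e'q bf; rewrite gowers_auxS => hf.
have a01 h := gowers_aux_itv01 n (bdisc_dermul h bf).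
have pos m : (0 < 2 ^ m)%N by rewrite expn_gt0.
have [N hN] := lim_root_average_large a01 (pos _) (pos _) e'2 hf.
apply: (large_average_pairs a01 e0 _ hN); have /andP[? _] := e'2.
by apply/andP; split; [rewrite !mulr_ge0// ltW|lra].
Qed.

(** Each multiplicative derivative is again a phase polynomial, of degree one lower, so by induction
    the averages are averages of [1] and this limit does exist. *)
Lemma gowers_aux_phase n f P : ergodic mu T -> bdisc f -> poly_deg mu T W n P ->
  {ae mu, forall x, f x = cexp2pi (P x)} -> G n f = 1.
Proof.
move=> hE; elim: n f P => [|n IH] f P bf hP fP.
  have [th hth] : exists th, {ae mu, forall x, cexp2pi (P x) = cexp2pi th}.
    apply: (invariant_phase_cst hT hE hP.1); have [_ /(_ [:: 1] erefl)] := hP.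
    by apply: filterS => x /= /cexp_eq.
  have [b1 b2] := bmeas_component bf.
  have fth : {ae mu, forall x, f x = cexp2pi th}.
    by apply: filterS2 fP hth => x -> .
  rewrite /= cabsE (_ : cintegral mu f = cexp2pi th) ?abs2_exp ?sqrtr1//.
  rewrite /cintegral [RHS]surjective_pairing; congr pair.
  - rewrite -(Rint_cst mu (cexp2pi th).1); apply: Rint_ae => //; first exact: bmeas_cst.
    by apply: filterS fth => x /= h; exact: (congr1 fst h).
  - rewrite -(Rint_cst mu (cexp2pi th).2); apply: Rint_ae => //; first exact: bmeas_cst.
    by apply: filterS fth => x /= h; exact: (congr1 snd h).
have G1 h : G n (dermul h f) = 1.
  apply: (IH _ (delta T W h%:Z P)); first exact: bdisc_dermul.
    exact: poly_deg_delta.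
  apply: filterS2 fP (ae_mpres (mpres_iterW h) fP) => x e1 e2.
  by rewrite cexp_delta Tpow_opp_nat /dermul e1 e2.
rewrite gowers_auxS; apply: cvg_lim => //.
(* Constancy starts at [H = 1]; the empty average at [H = 0] is [0]. *)
apply: cvg_near_cst.
near=> H; under eq_bigr do rewrite G1 expr1n.
rewrite sumr_const_nat subSS subn0 mulVf ?powR1//.
by rewrite pnatr_eq0 -lt0n; near: H; exists 1%N.
Unshelve. all: by end_near.
Qed.

(** The base case of the induction: for [c = m / |m|], with [m] the mean of [f], the squared
    distance from [f] to [c] is at most [2 - 2 |m|]. *)
Lemma large_mean_near_cst f (e : R) : bdisc f -> e < 1 -> 1 - e <= G 0 f ->
  exists th, dist2 mu f (fun=> cexp2pi th) <= 2 * e.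
Proof.
move=> bf e1 /=; set m := cintegral mu f; set r := cabs m => hr.
have r0 : 0 < r by lra.
have rE : r ^+ 2 = abs2 m := sqr_cabs m.
pose c := (m.1 / r, m.2 / r).
have c1 : abs2 c = 1.
  rewrite /abs2 /c /= !expr_div_n -mulrDl -/(abs2 m) -rE mulfV//.
  by rewrite expf_neq0// gt_eqF.
exists (carg c); rewrite (cargK c1).
rewrite (@dist2_cst_expand _ _ _ mu f c bf) ?c1// -/m.
have -> : c.1 * m.1 + c.2 * m.2 = r.
  rewrite /c /= mulrAC [X in _ + X]mulrAC -mulrDl -!expr2 -/(abs2 m) -rE.
  by rewrite expr2 mulfK// gt_eqF.
have : Rintegral mu setT (fun x => abs2 (f x)) <= 1.
  rewrite -[leRHS](Rint_cst mu 1); apply: Rint_le; [exact: bmeas_abs2|exact: bmeas_cst|].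
  by case: bf.
lra.
Qed.

End GowersBasics.

(** * The inverse theorem *)

Section InverseStep.
Context {R : realType} {d : measure_display} {X : measurableType d}.
Variables (mu : probability X R) (T W : X -> X).
Hypotheses (hT : mps mu T W) (hE : ergodic mu T).
Implicit Types (f u v : X -> R * R) (P Q : X -> R) (n h l m : nat) (dl : R).

Let TK : cancel T W. Proof. by case: hT. Qed.
Let WK : cancel W T. Proof. by case: hT. Qed.

Local Notation poly := (poly_deg mu T W).
Local Notation D := (dist2 mu).
Local Notation "'der' h f" := (dermul W h f) (at level 10, h, f at level 9).
Local Notation ex P := (fun x => cexp2pi (P x)).

(** Products of derivatives of [f] telescope only up to a factor [|f|^2]; this is that factor, as a
    complex-valued function. *)
Definition sqmod f : X -> R * R := fun x => (abs2 (f x), 0).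

Let bone : @bdisc R d X (fun=> (1, 0)).
Proof. by apply: bdisc_cst; rewrite abs2_1. Qed.

(** Since [|der m f|^2 <= |f|^2 <= 1], the function [|f|^2] is at least as close to [1] as
    [|der m f|^2], the product of [der m f] with its conjugate. *)
Lemma sqmod_near1 f Q m dl : bdisc f -> measurable_fun setT Q ->
  D (der m f) (ex Q) <= dl -> D (sqmod f) (fun=> (1, 0)) <= 4 * dl.
Proof.
move=> bf mQ hd; have bQ := bdisc_exp mQ; have bd := bdisc_dermul hT m bf.
have bc u : bdisc u -> bdisc (fun x => cconj (u x)) by exact: bdisc_cconj.
apply: (@le_trans _ _ (D (fun x => cmul (der m f x) (cconj (der m f x)))
    (fun x => cmul (cexp2pi (Q x)) (cconj (cexp2pi (Q x)))))); last first.
  apply: (le_trans (dist2_cmul mu bd (bc _ bd) bQ (bc _ bQ))).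
  by rewrite dist2_cconj; lra.
apply: dist2_le => //.
- exact: bdisc_abs2.
- exact: bdisc_cmul bd (bc _ bd).
- exact: bdisc_cmul bQ (bc _ bQ).
move=> x; rewrite !cmul_conj abs2_exp /dermul abs2_cmul abs2_cconj /sqmod !abs2_sub_real.
have := bf.2 (iter m W x); have := bf.2 x.
have := abs2_ge0 (f (iter m W x)); have := abs2_ge0 (f x).
move: (abs2 (f x)) (abs2 (f (iter m W x))) => a b *.
have ab : a * b <= a by rewrite ler_piMr.
nra.
Qed.

Lemma dist2_cmul_sqmod f v : bdisc f -> bdisc v ->
  D (fun x => cmul (v x) (sqmod f x)) v <= D (sqmod f) (fun=> (1, 0)).
Proof.
move=> bf bv; rewrite [X in D _ X](_ : v = fun x => cmul (v x) (1, 0)).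
  exact: (dist2_cmull mu (bdisc_abs2 bf) bone bv.2 bv.1).
by apply/funext => x; rewrite cmulz1.
Qed.

(* The derivatives in directions [m] and [m + h] have the ratio
   [(der h f) o W^m |f|^2]. *)
Lemma dermul_near_phase f h m Q1 Q2 n dl : bdisc f -> poly n Q1 -> poly n Q2 ->
  D (der m f) (ex Q1) <= dl -> D (der (m + h) f) (ex Q2) <= dl ->
  exists2 P, poly n P & D (der h f) (ex P) <= 16 * dl.
Proof.
move=> bf hQ1 hQ2 d1 d2; have E := sqmod_near1 bf hQ1.1 d1.
pose Q x := Q2 x - Q1 x; have hQ : poly n Q := poly_degB hQ2 hQ1.
pose v := der h f \o iter m W.
have bdh := bdisc_dermul hT h bf.
have bv : bdisc v := bdisc_comp (mpres_iterW hT m).1 bdh.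
have bQ1 := bdisc_exp hQ1.1; have bQ2 := bdisc_exp hQ2.1; have bQ := bdisc_exp hQ.1.
have b1 := bdisc_dermul hT m bf; have b2 := bdisc_dermul hT (m + h) bf.
(* [16 = 2 * 4 + 2 * 4]: inserting the factor [|f|^2], and multiplying the two approximations. *)
have dv : D v (ex Q) <= 16 * dl.
  have bvf : bdisc (fun x => cmul (v x) (sqmod f x)).
    by apply: bdisc_cmul => //; exact: bdisc_abs2.
  apply: (le_trans (dist2_triangle mu bv bvf bQ)).
  have h1 := dist2_cmul_sqmod bf bv; rewrite dist2C in h1.
  suff : D (fun x => cmul (v x) (sqmod f x)) (ex Q) <= 4 * dl by lra.
  have -> : (fun x => cmul (v x) (sqmod f x)) =
      fun x => cmul (der (m + h) f x) (cconj (der m f x)).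
    apply/funext => x; rewrite /v /dermul /sqmod /= -iterD addnC.
    by rewrite /cmul /cconj /abs2; congr pair => /=; ring.
  have -> : ex Q = fun x => cmul (cexp2pi (Q2 x)) (cconj (cexp2pi (Q1 x))).
    by apply/funext => x; rewrite cexpB.
  apply: (le_trans (dist2_cmul mu b2 (bdisc_cconj b1) bQ2 (bdisc_cconj bQ1))).
  by rewrite dist2_cconj; lra.
(* [Q] approximates [der h f] translated by [W^m]; composing with [T^m] undoes the translation and
   keeps the degree. *)
exists (fun x => Q (Tpow T W m%:Z x)); first exact: poly_deg_comp.
have bP : bdisc (ex (fun x => Q (Tpow T W m%:Z x))).
  by apply: bdisc_exp; have [] := poly_deg_comp hT m%:Z hQ.
rewrite -(dist2_mpres (mpres_iterW hT m) bdh bP); apply: le_trans dv.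
rewrite le_eqVlt; apply/orP; left; apply/eqP; congr (D _ _); apply/funext => x /=.
by have := Tpow_add TK WK m%:Z (- m%:Z) x; rewrite subrr Tpow_opp_nat /= => <-.
Qed.

(** The derivatives satisfy the cocycle identity up to the factor [|f o W^l|^2]: [der (h + l) f]
    times it equals [der h f o W^l] times [der l f]. Two triangle inequalities give
    [22 = 2 + 2 * (2 + 2 * 4)]. *)
Lemma dermul_cocycle f h l P Q S dl : bdisc f ->
  measurable_fun setT P -> measurable_fun setT Q -> measurable_fun setT S ->
  D (sqmod f) (fun=> (1, 0)) <= dl ->
  D (der h f) (ex P) <= dl -> D (der l f) (ex Q) <= dl ->
  D (der (h + l) f) (ex S) <= dl ->
  D (ex S) (ex (fun x => P (iter l W x) + Q x)) <= 22 * dl.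
Proof.
move=> bf mP mQ mS E dP dQ dS.
have Wl := mpres_iterW hT l.
have bP := bdisc_exp mP; have bQ := bdisc_exp mQ; have bS := bdisc_exp mS.
have bPl := bdisc_comp Wl.1 bP.
have bPQ : bdisc (ex (fun x => P (iter l W x) + Q x)).
  by apply: bdisc_exp; apply: measurable_funD => //; exact: (measurableT_comp mP Wl.1).
have bh := bdisc_dermul hT h bf; have bl := bdisc_dermul hT l bf.
have bhl := bdisc_dermul hT (h + l) bf.
have bfl := bdisc_comp Wl.1 bf.
have bm : bdisc (fun x => cmul (der (h + l) f x) (sqmod (f \o iter l W) x)).
  by apply: bdisc_cmul => //; exact: bdisc_abs2.
apply: (le_trans (dist2_triangle mu bS bhl bPQ)); rewrite (dist2C mu (ex S)).
have h2 := dist2_triangle mu bhl bm bPQ.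
have h1 := dist2_cmul_sqmod bfl bhl; rewrite dist2C in h1.
have El : D (sqmod (f \o iter l W)) (fun=> (1, 0)) = D (sqmod f) (fun=> (1, 0)).
  exact: dist2_mpres Wl (bdisc_abs2 bf) bone.
suff : D (fun x => cmul (der (h + l) f x) (sqmod (f \o iter l W) x))
    (ex (fun x => P (iter l W x) + Q x)) <= 4 * dl.
  by rewrite El in h1; lra.
have -> : (fun x => cmul (der (h + l) f x) (sqmod (f \o iter l W) x)) =
    fun x => cmul (der h f (iter l W x)) (der l f x).
  apply/funext => x; rewrite /dermul /sqmod /= -iterD.
  by rewrite /cmul /cconj /abs2; congr pair => /=; ring.
have -> : ex (fun x => P (iter l W x) + Q x) =
    fun x => cmul (cexp2pi (P (iter l W x))) (cexp2pi (Q x)).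
  by apply/funext => x; rewrite cexpD.
apply: (le_trans (dist2_cmul mu (bdisc_comp Wl.1 bh) bl bPl bQ)).
by rewrite (dist2_mpres Wl bh bP); lra.
Qed.

(** The additive cocycle over [W] whose value at time [1] is [P]. *)
Fixpoint birkhoff P h : X -> R :=
  if h is h'.+1 then fun x => birkhoff P h' (W x) + P x else fun=> 0.

Lemma measurable_birkhoff P h : measurable_fun setT P ->
  measurable_fun setT (birkhoff P h).
Proof.
move=> mP; elim: h => [|h IH] /=; first exact: measurable_cst.
by apply: measurable_funD => //; exact: (measurableT_comp IH (mpres_W hT).1).
Qed.

Lemma birkhoffD P h l x :
  birkhoff P (h + l) x = birkhoff P h (iter l W x) + birkhoff P l x.
Proof.
elim: l x => [|l IH] x; first by rewrite addn0 addr0.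
by rewrite addnS /= IH -iterSr addrA.
Qed.

(** In the induction on [h] the error does not grow: the hypothesis supplies a fresh [S] for
    [h + 1], the cocycle relation puts it within [22 dl] of the predicted polynomial [A], and
    rigidity makes [e(S)] and [e(A)] equal up to a constant. *)
Lemma dermul_near_birkhoff f n dl : bdisc f -> 22 * dl <= (4 ^+ n)^-1 ->
  D (sqmod f) (fun=> (1, 0)) <= dl ->
  (forall h, exists2 P, poly n P & D (der h f) (ex P) <= dl) ->
  exists2 P, poly n P & forall h, exists t,
    D (der h f) (ex (fun x => birkhoff P h x + t)) <= dl.
Proof.
move=> bf dln E hder; have [P hP dP] := hder 1%N; exists P => //.
have mB h t : measurable_fun setT (fun x => birkhoff P h x + t).
  apply: measurable_funD; last exact: measurable_cst.
  by apply: measurable_birkhoff; case: hP.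
suff main h : exists Q t, [/\ poly n Q, D (der h f) (ex Q) <= dl &
    {ae mu, forall x, cexp2pi (Q x) = cexp2pi (birkhoff P h x + t)}].
  move=> h; have [Q [t [hQ dQ Qt]]] := main h; exists t.
  apply: le_trans dQ; rewrite le_eqVlt; apply/orP; left; apply/eqP.
  rewrite dist2C (dist2C mu _ (ex Q)); apply: dist2_ael.
  - exact: bdisc_exp.
  - by apply: bdisc_exp; case: hQ.
  - exact: (bdisc_dermul hT h bf).
  - by apply: filterS Qt => x ->.
elim: h => [|h [Q [t [hQ dQ Qt]]]].
  exists (fun=> 0), 0; split; first exact: poly_deg_cst.
    rewrite (_ : der 0 f = sqmod f) ?cexp0//.
    by apply/funext => x; rewrite /dermul /= cmul_conj.
  by apply: aeW => x /=; rewrite addr0.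
have [S hS dS] := hder h.+1; rewrite -addn1 in dS.
have := dermul_cocycle bf hQ.1 hP.1 hS.1 E dQ dP dS.
pose A x := Q (iter 1 W x) + P x; rewrite -/A => dSA.
have hA : poly n A.
  by apply: poly_degD => //; exact: (poly_deg_comp hT (-1) hQ).
have bS := bdisc_exp hS.1; have bA := bdisc_exp hA.1.
have [th hth] : exists th, {ae mu, forall x, cexp2pi (S x - A x) = cexp2pi th}.
  apply: (phase_rigidity hT hE (c := (1, 0)) (poly_degB hS hA)).
    exact: abs2_1.
  apply: le_trans dln; apply: le_trans dSA.
  have -> : (fun x => cexp2pi (S x - A x)) =
      fun x => cmul (cconj (cexp2pi (A x))) (cexp2pi (S x)).
    by apply/funext => x; rewrite cexpB cmulC.
  have -> : (fun=> (1, 0)) = fun x => cmul (cconj (cexp2pi (A x))) (cexp2pi (A x)).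
    by apply/funext => x; rewrite cmulC cmul_conj abs2_exp.
  by have [mA A1] := bdisc_cconj bA; apply: dist2_cmull.
exists S, (th + t); split=> //; first by rewrite -addn1.
apply: filterS2 hth (ae_mpres (mpres_W hT) Qt) => x e1 e2.
have -> : cexp2pi (S x) = cmul (cexp2pi (S x - A x)) (cexp2pi (A x)).
  by rewrite -cexpD subrK.
rewrite e1 /A cexpD e2 -!cexpD /=.
by congr cexp2pi; ring.
Qed.

Lemma iter_twist_birkhoff f P (a : R) h x :
  iter h (twist W (fun x => cexp2pi (- (P x + a)))) f x =
  cmul (cexp2pi (- (birkhoff P h x + a * h%:R))) (f (iter h W x)).
Proof.
elim: h x => [|h IH] x; first by rewrite /= mulr0 addr0 oppr0 cexp0 cmul1z.
rewrite iterS /twist IH cmulA -cexpD -iterSr; congr (cmul (cexp2pi _) _).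
by rewrite /= -natr1; ring.
Qed.

(** Writing [g] for the twisted iterate and [q] for the cocycle, [g |f|^2 = e(-q) f * der h f],
    whereas [f = e(-q) f * e(q)]; hence [der h f] near [e(q)] makes the orbit return near [f]. *)
Lemma twist_orbit_near f P (a : R) dl (e : R) h : bdisc f ->
  measurable_fun setT P -> D (sqmod f) (fun=> (1, 0)) <= dl ->
  D (der h f) (ex (fun x => birkhoff P h x + a * h%:R)) <= e ->
  D (iter h (twist W (fun x => cexp2pi (- (P x + a)))) f) f <= 2 * dl + 2 * e.
Proof.
move=> bf mP E he; pose q x := birkhoff P h x + a * h%:R.
have mq : measurable_fun setT q.
  apply: measurable_funD; last exact: measurable_cst.
  exact: measurable_birkhoff.
have bq := bdisc_exp mq; have bNq := bdisc_exp (measurable_funN mq).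
pose g x := cmul (cexp2pi (- q x)) (f (iter h W x)).
have -> : iter h (twist W (fun x => cexp2pi (- (P x + a)))) f = g.
  by apply/funext => x; rewrite iter_twist_birkhoff.
have bg : bdisc g by apply: bdisc_cmul => //; exact: bdisc_comp (mpres_iterW hT h).1 bf.
have bgf : bdisc (fun x => cmul (g x) (sqmod f x)).
  by apply: bdisc_cmul => //; exact: bdisc_abs2.
apply: (le_trans (dist2_triangle mu bg bgf bf)).
have := dist2_cmul_sqmod bf bg; rewrite dist2C => h1.
suff : D (fun x => cmul (g x) (sqmod f x)) f <= e by lra.
pose w x := cmul (cexp2pi (- q x)) (f x).
have bw : bdisc w by exact: bdisc_cmul.
have -> : (fun x => cmul (g x) (sqmod f x)) = fun x => cmul (w x) (der h f x).
  apply/funext => x; rewrite /g /w /dermul /sqmod.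
  by rewrite /cmul /cconj /abs2; congr pair => /=; ring.
rewrite [X in D _ X](_ : f = fun x => cmul (w x) (cexp2pi (q x))).
  apply: le_trans he; exact: (dist2_cmull mu (bdisc_dermul hT h bf) bq bw.2 bw.1).
apply/funext => x; rewrite /w cmulC cmulA -cexpD subrr cexp0 cmul1z//.
Qed.

(** The unimodular twist makes [|F|^2] invariant, hence a constant [c.1] by ergodicity. As [F] is
    near [f] and [|f|^2] is near [1], [(c.1 - 1)^2] is at most [8 e + 2 dl < 1], so [c.1 > 0] and
    [F] can be normalised. *)
Lemma invariant_near_phase f F P n (a : R) dl (e : R) : bdisc f -> bdisc F ->
  poly n P -> D (sqmod f) (fun=> (1, 0)) <= dl -> D F f <= e ->
  {ae mu, forall x, twist W (fun x => cexp2pi (- (P x + a))) F x = F x} ->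
  8 * e + 2 * dl < 1 ->
  exists2 Q, poly n.+1 Q & D f (ex Q) <= 18 * e + 4 * dl.
Proof.
move=> bf bF hP E dF inv small.
have bF2 := bdisc_abs2 bF; have bf2 := bdisc_abs2 bf.
have FW : {ae mu, forall x, F (W x) = cmul (cexp2pi (P x + a)) (F x)}.
  by apply: filterS inv => x <-; rewrite /twist cmulA -cexpD subrr cexp0 cmul1z.
have [c hc] : exists c, {ae mu, forall x, sqmod F x = c}.
  apply: (ergodic_invariant_cst hT hE bF2); apply: filterS FW => x ->.
  by rewrite abs2_cmul abs2_exp mul1r.
have {}hc : {ae mu, forall x, abs2 (F x) = c.1} by apply: filterS hc => x <-.
have c_near : (c.1 - 1) ^+ 2 <= 8 * e + 2 * dl.
  have -> : (c.1 - 1) ^+ 2 = D (sqmod F) (fun=> (1, 0)).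
    rewrite -(Rint_cst mu ((c.1 - 1) ^+ 2)); apply: Rint_ae; first exact: bmeas_cst.
      exact: bmeas_abs2B bF2 bone.
    by apply: filterS hc => x <-; rewrite /sqmod abs2_sub_real.
  apply: (le_trans (dist2_triangle mu bF2 bf2 bone)).
  suff : D (sqmod F) (sqmod f) <= 4 * e by lra.
  have sqE u : sqmod u = fun x => cmul (u x) (cconj (u x)).
    by apply/funext => x; rewrite cmul_conj.
  rewrite !sqE; apply: (le_trans (dist2_cmul mu bF (bdisc_cconj bF) bf (bdisc_cconj bf))).
  by rewrite dist2_cconj; lra.
have c0 : 0 < c.1 by nra.
pose r := Num.sqrt c.1; have r0 : 0 < r by rewrite sqrtr_gt0.
have r2 : r ^+ 2 = c.1 by rewrite sqr_sqrtr// ltW.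
pose G x : R * R := ((F x).1 / r, (F x).2 / r).
have mG : cmeasurable G.
  have [[m1 m2] _] := bF.
  by split; apply: measurable_funM => //; exact: measurable_cst.
have abs2G x : abs2 (G x) = abs2 (F x) / c.1.
  by rewrite -r2 /G /abs2 /= !expr_div_n mulrDl.
pose Q x := carg (G x).
have mQ : measurable_fun setT Q := measurable_carg mG.
have QG : {ae mu, forall x, cexp2pi (Q x) = G x}.
  by apply: filterS hc => x hx; apply: cargK; rewrite abs2G hx divff// gt_eqF.
have bQ := bdisc_exp mQ.
(* Normalising moves [F] by [|r - 1|], which is at most [|r - 1| (r + 1) = |c.1 - 1|]. *)
have dFQ : D F (ex Q) <= 8 * e + 2 * dl.
  apply: le_trans c_near.
  suff -> : D F (ex Q) = (r - 1) ^+ 2.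
    rewrite -r2 (_ : r ^+ 2 - 1 = (r - 1) * (r + 1)); last by ring.
    by rewrite exprMn ler_peMr ?sqr_ge0//; nra.
  rewrite -[RHS](Rint_cst mu); apply: Rint_ae; first exact: bmeas_abs2B.
    exact: bmeas_cst.
  apply: filterS2 hc QG => x hx ->.
  have -> : abs2 (F x - G x) = abs2 (F x) * (1 - r^-1) ^+ 2.
    by rewrite /abs2 /G /=; ring.
  by rewrite hx -r2 -exprMn mulrBr mulr1 mulfV ?gt_eqF.
exists Q; last first.
  by apply: (le_trans (dist2_triangle mu bf bF bQ)); rewrite (dist2C mu f); lra.
apply: (poly_deg_of_delta1 hT mQ).
have hPa : poly n (fun x => P x + a) by apply: poly_degD => //; exact: poly_deg_cst.
(* The equation for [F] gives [G o W * conj G = e(P + a)], so [delta 1 Q] and [P + a] differ by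
   integers. *)
apply: (poly_deg_eq_mod hT hPa); first exact: (measurable_delta hT 1 mQ).
have QW := ae_mpres (mpres_W hT) QG.
apply: filterS2 hc (filterI (filterI QG QW) FW) => x hx [[e1 e2] e3].
apply/cexp_eq; rewrite cexp_delta /= e1 e2.
have -> : cmul (G (W x)) (cconj (G x)) =
    cmul (cexp2pi (P x + a)) (abs2 (F x) / c.1, 0).
  rewrite -r2 /G e3; move: (cexp2pi _) (F x) => z w.
  by rewrite /cmul /cconj /abs2 /=; congr pair; field; rewrite gt_eqF.
by rewrite hx divff ?gt_eqF// cmulz1.
Qed.

End InverseStep.

(** * The uniform inverse statement, by induction on the degree *)

Section InverseTheorem.
Variable R : realType.

(** The index [n] stands for [U^(n+1)]. Choosing [e] before the system is what lets [c_k] depend on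
    [k] alone. *)
Definition inverse_statement (n : nat) := forall dl : R, 0 < dl ->
  exists2 e : R, 0 < e < 1 &
  forall (d : measure_display) (X : measurableType d) (mu : probability X R)
    (T W : X -> X), mps mu T W -> ergodic mu T -> forall f : X -> R * R, bdisc f ->
    1 - e <= gowers_aux mu T W n f ->
    exists2 P, poly_deg mu T W n P & dist2 mu f (fun x => cexp2pi (P x)) <= dl.

Lemma inverse_step n : inverse_statement n -> inverse_statement n.+1.
Proof.
move=> IH dl dl0.
(* The cap [1] secures the smallness condition of [invariant_near_phase]. *)
pose s := Num.min dl 1.
have s0 : 0 < s by rewrite lt_min dl0 ltr01.
have sdl : s <= dl by rewrite ge_min lexx.
have s1 : s <= 1 by rewrite ge_min lexx orbT.
have [k0 k00 hk0] := @approx_character R (s / 200) ltac:(lra).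
pose r := (4 ^+ n)^-1 : R.
have r0 : 0 < r by rewrite invr_gt0 exprn_gt0.
(* The three caps serve the final error, the approximate character formed by the constants, and the
   rigidity threshold; [22] is the loss in [dermul_cocycle]. *)
pose d1 := Num.min (s / 400) (Num.min (k0 / 22) (r / 22)).
have d10 : 0 < d1 by rewrite !lt_min !divr_gt0.
have d1s : d1 <= s / 400 by rewrite ge_min lexx.
have d1k : d1 <= k0 / 22 by rewrite /d1 !ge_min lexx orbT.
have d1r : d1 <= r / 22 by rewrite /d1 !ge_min lexx !orbT.
(* [16] is the loss in passing from two good directions to their difference. *)
have [e e01 he] := IH (d1 / 16) ltac:(lra).
have /andP[e0 _] := e01.
pose q : R := (2 ^ n.+2)%N%:R.
have q1 : 1 <= q by rewrite ler1n expn_gt0.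
pose e' := Num.min 2^-1 (e / (8 * q)).
have e'0 : 0 < e' by rewrite lt_min invr_gt0 ltr0n divr_gt0//; lra.
have e'2 : e' <= 2^-1 by rewrite ge_min lexx.
have e'q : 8 * q * e' <= e.
  have : e' <= e / (8 * q) by rewrite ge_min lexx orbT.
  by rewrite ler_pdivlMr; lra.
exists e'; first by rewrite e'0; lra.
move=> d X mu T W hT hE f bf hf.
have e'b : 0 < e' <= 2^-1 by rewrite e'0.
have pairs := gowers_aux_pairs hT e0 e'b e'q bf hf.
have near m : 1 - e <= gowers_aux mu T W n (dermul W m f) ->
    exists2 P, poly_deg mu T W n P &
      dist2 mu (dermul W m f) (fun x => cexp2pi (P x)) <= d1 / 16.
  by apply: he => //; exact: (bdisc_dermul hT m bf).
have hder h : exists2 P, poly_deg mu T W n P &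
    dist2 mu (dermul W h f) (fun x => cexp2pi (P x)) <= d1.
  have [m [/near[Q1 hQ1 dQ1] /near[Q2 hQ2 dQ2]]] := pairs h.
  have [P hP dP] := dermul_near_phase hT bf hQ1 hQ2 dQ1 dQ2.
  by exists P => //; lra.
have E : dist2 mu (sqmod f) (fun=> (1, 0)) <= d1.
  have [m [/near[Q1 hQ1 dQ1] _]] := pairs 0%N.
  by have := sqmod_near1 hT bf hQ1.1 dQ1; lra.
have d1n : 22 * d1 <= (4 ^+ n)^-1 by rewrite -/r; lra.
have [P hP hPt] := dermul_near_birkhoff hT hE bf d1n E hder.
have [t ht] := choice hPt.
have mB h (a : R) : measurable_fun setT (fun x => birkhoff W P h x + a).
  apply: measurable_funD; last exact: measurable_cst.
  exact: (measurable_birkhoff hT h hP.1).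
have bB h (a : R) := bdisc_exp (mB h a).
have pB (p a b : R) : abs2 (cexp2pi (p + a) - cexp2pi (p + b)) =
    abs2 (cexp2pi a - cexp2pi b).
  rewrite cexp_dist [RHS]cexp_dist; congr (abs2 (cexp2pi _ - _)); ring.
(* The Birkhoff sums satisfy the cocycle relation exactly and cancel, leaving an approximate
   relation between the numbers [t h] alone. *)
have [a ha] : exists a : R, forall h,
    abs2 (cexp2pi (t h) - cexp2pi (a * h%:R)) <= s / 200.
  apply: hk0 => h l.
  have := dermul_cocycle hT bf (mB h (t h)) (mB l (t l)) (mB (h + l)%N (t (h + l)%N))
    E (ht h) (ht l) (ht (h + l)%N).
  rewrite (_ : dist2 mu _ _ = abs2 (cexp2pi (t (h + l)%N) - cexp2pi (t h + t l))).
    by lra.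
  rewrite -(Rint_cst mu (abs2 _)); apply: eq_Rintegral => x _.
  have -> : birkhoff W P h (iter l W x) + t h + (birkhoff W P l x + t l) =
      birkhoff W P (h + l) x + (t h + t l) by rewrite birkhoffD; ring.
  exact: pB.
have near_a h : dist2 mu (dermul W h f)
    (fun x => cexp2pi (birkhoff W P h x + a * h%:R)) <= 2 * d1 + 2 * (s / 200).
  apply: (le_trans (dist2_triangle mu (bdisc_dermul hT h bf) (bB h (t h)) (bB h _))).
  have := ht h; have := ha h.
  rewrite [X in _ -> _ -> _ + 2 * X <= _](_ : _ = abs2 (cexp2pi (t h) - cexp2pi (a * h%:R))).
    by lra.
  by rewrite -(Rint_cst mu (abs2 _)); apply: eq_Rintegral => x _; exact: pB.
pose rho x := cexp2pi (- (P x + a)).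
have brho : bdisc rho.
  apply: bdisc_exp; apply: measurable_funN; apply: measurable_funD; first by case: hP.
  exact: measurable_cst.
have rho1 x : abs2 (rho x) = 1 by exact: abs2_exp.
have orbit h := twist_orbit_near hT bf hP.1 E (near_a h).
have [F [bF Finv dF]] := almost_invariant (mpres_W hT) brho.1 rho1 bf orbit.
have [|Q hQ dQ] := invariant_near_phase hT hE bf bF hP E dF Finv; first by lra.
by exists Q => //; lra.
Qed.

Lemma inverse_theorem n : inverse_statement n.
Proof.
elim: n => [|n IH]; last exact: inverse_step.
move=> dl dl0; pose e := Num.min 2^-1 (dl / 2).
have e0 : 0 < e by rewrite lt_min invr_gt0 ltr0n divr_gt0.
have e2 : e <= 2^-1 by rewrite ge_min lexx.
have edl : e <= dl / 2 by rewrite ge_min lexx orbT.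
have e1 : e < 1 by lra.
exists e; first by rewrite e0.
move=> d X mu T W hT hE f bf hf; have [th hth] := large_mean_near_cst bf e1 hf.
by exists (fun=> th); [exact: poly_deg_cst|lra].
Qed.

End InverseTheorem.

(** * Exact extremisers, and reduction to values in the closed disc *)

Section Extremisers.
Context {R : realType} {d : measure_display} {X : measurableType d}.
Variables (mu : probability X R) (T W : X -> X).
Hypotheses (hT : mps mu T W) (hE : ergodic mu T).
Implicit Types (f : X -> R * R) (P : X -> R).

Lemma abs2_cintegral_sub f (c : R * R) : bdisc f -> abs2 c <= 1 ->
  abs2 (cintegral mu f - c) <= dist2 mu f (fun=> c).
Proof.
move=> bf c1; rewrite (@dist2_cst_expand _ _ _ mu f c bf c1).
have := abs2_cintegral_le mu bf; rewrite {2 4}/abs2 /=.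
move: (Rintegral _ _ _) (cintegral mu f).1 (cintegral mu f).2 => I m1 m2.
by rewrite /abs2 /=; nra.
Qed.

(** Approximants of [f] at every scale differ from a fixed [P] by constants, by rigidity. So
    [f * conj e(P)] is arbitrarily close to unimodular constants, and is therefore one itself. *)
Lemma extremiser_phase n f : bdisc f -> gowers_aux mu T W n f = 1 ->
  exists2 P, poly_deg mu T W n P & {ae mu, forall x, f x = cexp2pi (P x)}.
Proof.
move=> bf Gf; pose r : R := (4 ^+ n)^-1.
have r0 : 0 < r by rewrite invr_gt0 exprn_gt0.
have approx (dl : R) : 0 < dl -> exists2 P, poly_deg mu T W n P &
    dist2 mu f (fun x => cexp2pi (P x)) <= dl.
  move=> /(inverse_theorem n)[e /andP[e0 _] he]; apply: (he _ _ _ _ _ hT hE) => //.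
  by rewrite Gf; lra.
(* Two approximants within [r / 4] of [f] are within [r] of each other, the rigidity threshold. *)
have [P hP dP] := approx (r / 4) ltac:(lra).
have bP := bdisc_exp hP.1; have bcP := bdisc_cconj bP.
pose g x := cmul (cconj (cexp2pi (P x))) (f x).
have bg : bdisc g by exact: bdisc_cmul.
have near_cst (dl : R) : 0 < dl -> exists th, dist2 mu g (fun=> cexp2pi th) <= dl.
  move=> dl0; pose s := Num.min dl (r / 4).
  have s0 : 0 < s by rewrite lt_min dl0 divr_gt0.
  have sdl : s <= dl by rewrite ge_min lexx.
  have sr : s <= r / 4 by rewrite ge_min lexx orbT.
  have [Q hQ dQ] := approx s s0; have bQ := bdisc_exp hQ.1.
  have dPQ := dist2_triangle mu bQ bf bP; rewrite (dist2C mu _ f) in dPQ.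
  have eQP : (fun x => cexp2pi (Q x - P x)) =
      fun x => cmul (cconj (cexp2pi (P x))) (cexp2pi (Q x)).
    by apply/funext => x; rewrite cexpB cmulC.
  have bQP : bdisc (fun x => cexp2pi (Q x - P x)).
    by apply: bdisc_exp; apply: measurable_funB; [case: hQ|case: hP].
  have [th hth] : exists th, {ae mu, forall x, cexp2pi (Q x - P x) = cexp2pi th}.
    apply: (phase_rigidity hT hE (c := (1, 0)) (poly_degB hQ hP)); first exact: abs2_1.
    rewrite eQP (_ : (fun=> (1, 0)) =
        fun x => cmul (cconj (cexp2pi (P x))) (cexp2pi (P x))); last first.
      by apply/funext => x; rewrite cmulC cmul_conj abs2_exp.
    by apply: (le_trans (dist2_cmull mu bQ bP bcP.2 bcP.1)); rewrite -/r; lra.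
  exists th; apply: le_trans sdl; apply: le_trans dQ.
  have bth : @bdisc R d X (fun=> cexp2pi th) by apply: bdisc_cst; rewrite abs2_exp.
  rewrite dist2C (dist2_ael (u' := fun x => cexp2pi (Q x - P x))) //; last first.
    by apply: filterS hth => x ->.
  rewrite eQP dist2C; exact: (dist2_cmull mu bf bQ bcP.2 bcP.1).
(* The mean of [g] is the limit of the constants [e(th)], so no subsequence has to be extracted. *)
pose c := cintegral mu g.
have c_near (dl : R) : 0 < dl -> exists th,
    abs2 (c - cexp2pi th) <= dl /\ dist2 mu g (fun=> cexp2pi th) <= dl.
  move=> /near_cst[th hth]; exists th; split=> //; apply: le_trans hth.
  by apply: abs2_cintegral_sub => //; rewrite abs2_exp.
have bg2 := bmeas_abs2 bg.
have c1 : abs2 c <= 1.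
  apply: (le_trans (abs2_cintegral_le mu bg)).
  by rewrite -[leRHS](Rint_cst mu 1); apply: Rint_le; [|exact: bmeas_cst|exact: bg.2].
have bc : @bdisc R d X (fun=> c) by exact: bdisc_cst.
have small0 (y : R) : (forall dl, 0 < dl -> y <= 4 * dl) -> y <= 0.
  by move=> h; rewrite leNgt; apply/negP => y0; have := h (y / 8) ltac:(lra); lra.
have gc : {ae mu, forall x, g x = c}.
  apply: (dist2_eq0 bg bc); apply: small0 => dl /c_near[th [h1 h2]].
  have bth : @bdisc R d X (fun=> cexp2pi th) by apply: bdisc_cst; rewrite abs2_exp.
  apply: (le_trans (dist2_triangle mu bg bth bc)).
  by rewrite dist2_cst abs2C; lra.
have c_unit : abs2 c = 1.
  apply/eqP; rewrite -subr_eq0 -sqrf_eq0 eq_le sqr_ge0 andbT.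
  apply: small0 => dl /c_near[th [h1 _]].
  rewrite -abs2_sub_real -cmul_conj -(abs2_exp th) -cmul_conj.
  apply: (le_trans (abs2_subM _ _ _ _)); rewrite ?abs2_cconj ?abs2_exp//.
  by rewrite -cconjB abs2_cconj; lra.
exists (fun x => P x + carg c).
  by apply: poly_degD => //; exact: poly_deg_cst.
apply: filterS gc => x; rewrite cexpD (cargK c_unit) => <-.
by rewrite /g cmulA cmul_conj abs2_exp cmul1z.
Qed.

Lemma L1dist_ae f f' g : cmeasurable f -> cmeasurable f' -> cmeasurable g ->
  {ae mu, forall x, f x = f' x} -> L1dist mu f g = L1dist mu f' g.
Proof.
move=> mf mf' [g1 g2] ff'.
have mcabs u : cmeasurable u ->
    measurable_fun setT (fun x => (cabs ((u x).1 - (g x).1, (u x).2 - (g x).2))%:E).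
  move=> [u1 u2]; apply/measurable_EFinP.
  apply: (@measurableT_comp _ _ _ _ _ _ (@Num.sqrt R)).
    by apply: continuous_measurable_fun; exact: sqrt_continuous.
  by apply: measurable_funD; apply: measurable_funX; exact: measurable_funB.
congr fine; apply: ae_eq_integral => //; try exact: mcabs.
by apply: filterS ff' => x /= ->.
Qed.

Lemma linf_le1_trunc f : linf_le1 mu f ->
  bdisc (fun x => disc_trunc (f x)) /\
  {ae mu, forall x, f x = disc_trunc (f x)}.
Proof.
move=> [mf f1]; split; first exact: bdisc_trunc.
by apply: filterS f1 => x; rewrite cabs_le1 => /disc_trunc_id.
Qed.

Lemma L1dist_linf_le1 f P : linf_le1 mu f -> measurable_fun setT P ->
  L1dist mu f (fun x => cexp2pi (P x)) <=
  Num.sqrt (dist2 mu (fun x => disc_trunc (f x)) (fun x => cexp2pi (P x))).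
Proof.
move=> hf mP; have [b0 f0] := linf_le1_trunc hf; have bP := bdisc_exp mP.
rewrite (L1dist_ae hf.1 b0.1 bP.1 f0); exact: L1dist_le.
Qed.

Lemma gowers_aux_trunc n f : linf_le1 mu f ->
  gowers_aux mu T W n f = gowers_aux mu T W n (fun x => disc_trunc (f x)).
Proof.
move=> hf; have [b0 f0] := linf_le1_trunc hf.
exact: (gowers_aux_ae hT n hf.1 b0.1 f0).
Qed.

End Extremisers.

(** * Both statements, and the modulus [c_k] *)

Theorem theorem1p12 (R : realType) (k : nat) (hk : (1 <= k)%N) :
  (forall (d : measure_display) (X : measurableType d) (mu : probability X R)
          (T Tinv : X -> X),
      mps mu T Tinv -> ergodic mu T ->
      forall f : X -> R * R, linf_le1 mu f ->
        (gowers mu T Tinv k f = 1 <->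
         exists P : X -> R, poly_deg mu T Tinv k.-1 P /\
           {ae mu, forall x, f x = cexp2pi (P x)}))
  /\
  (exists c : R -> R,
      (forall e : R, 0 <= e -> 0 <= c e) /\
      (c e @[e --> 0^'+] --> 0) /\
      forall (d : measure_display) (X : measurableType d) (mu : probability X R)
             (T Tinv : X -> X),
        mps mu T Tinv -> ergodic mu T ->
        forall (f : X -> R * R) (eps : R), linf_le1 mu f -> 0 <= eps ->
          1 - eps <= gowers mu T Tinv k f ->
          exists P : X -> R, poly_deg mu T Tinv k.-1 P /\
            L1dist mu f (fun x => cexp2pi (P x)) <= c eps).
Proof.
rewrite /gowers; move: k.-1 => n {k hk}.
have extremiser d (X : measurableType d) (mu : probability X R) (T W : X -> X) :
    mps mu T W -> ergodic mu T -> forall f : X -> R * R, linf_le1 mu f ->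
    (gowers_aux mu T W n f = 1 <->
     exists P : X -> R, poly_deg mu T W n P /\
       {ae mu, forall x, f x = cexp2pi (P x)}).
  move=> hT hE f hf; have [b0 f0] := linf_le1_trunc hf.
  rewrite (gowers_aux_trunc hT n hf); split.
    move=> /(extremiser_phase hT hE b0)[P hP fP]; exists P; split=> //.
    by apply: filterS2 f0 fP => x e1 e2; rewrite e1.
  move=> [P [hP fP]]; apply: (gowers_aux_phase hT hE b0 hP).
  by apply: filterS2 f0 fP => x <-.
split; first exact: extremiser.
(* The L^1 errors that are admissible at level [e] in all systems at once; their infimum is the
   natural modulus. *)
pose good (e : R) := [set dl : R | 0 <= dl /\
  forall (d : measure_display) (X : measurableType d) (mu : probability X R)
    (T W : X -> X), mps mu T W -> ergodic mu T ->
  forall f : X -> R * R, linf_le1 mu f -> 1 - e <= gowers_aux mu T W n f ->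
  exists P : X -> R, poly_deg mu T W n P /\
    L1dist mu f (fun x => cexp2pi (P x)) <= dl].
have inf_good e : has_inf (good e).
  split; last by exists 0 => dl [].
  (* The phase [1] is within [2] of every [f]. *)
  exists 2; split=> // d X mu T W hT hE f hf _.
  exists (fun=> 0); split; first exact: poly_deg_cst.
  have mP0 : measurable_fun setT (fun _ : X => 0 : R) by exact: measurable_cst.
  apply: (le_trans (L1dist_linf_le1 hf mP0)).
  have [b0 _] := linf_le1_trunc hf.
  rewrite -(ler_pXn2r (_ : 0 < 2)%N) ?nnegrE ?sqrtr_ge0// sqr_sqrtr ?dist2_ge0//.
  have b1 : bdisc (fun _ : X => cexp2pi (0 : R)) by apply: bdisc_cst; rewrite abs2_exp.
  have bz : @bdisc R d X (fun=> 0).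
    by apply: bdisc_cst; rewrite /abs2 /= expr0n /= addr0.
  apply: (le_trans (dist2_triangle mu b0 bz b1)).
  have d1 : dist2 mu (fun x => disc_trunc (f x)) (fun=> 0) <= 1.
    rewrite -[leRHS](Rint_cst mu 1); apply: Rint_le => [||x].
    - exact: bmeas_abs2B.
    - exact: bmeas_cst.
    - by rewrite subr0; exact: b0.2.
  by rewrite dist2_cst abs2C subr0 abs2_exp; lra.
have good_ge0 e : 0 <= inf (good e).
  by apply: lb_le_inf; [exact: (inf_good e).1|move=> dl []].
(* The infimum need not be admissible; the summand [e] leaves room for an element of [good e] when
   [e > 0]. *)
exists (fun e => inf (good e) + e); split; [|split].
- by move=> e e0; rewrite addr_ge0.
- apply/cvgrPdist_le => s s0.
  (* The square compensates the square root in the passage from [dist2] to the L^1 distance. *)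
  have [e0 /andP[e00 _] he0] := @inverse_theorem R n ((s / 2) ^+ 2) ltac:(nra).
  near=> e.
  have e_gt0 : 0 < e by near: e; exact: nbhs_right_gt.
  have ee0 : e < e0 by near: e; exact: nbhs_right_lt.
  have es : e < s / 2 by near: e; apply: nbhs_right_lt; lra.
  rewrite sub0r normrN ger0_norm ?addr_ge0// ?ltW//.
  suff : inf (good e) <= s / 2 by lra.
  apply: inf_lbound; first exact: (inf_good e).2.
  split; first by lra.
  move=> d X mu T W hT hE f hf hG; have [b0 _] := linf_le1_trunc hf.
  have [|P hP dP] := he0 _ _ _ _ _ hT hE _ b0.
    by rewrite -(gowers_aux_trunc hT n hf); lra.
  exists P; split=> //; apply: (le_trans (L1dist_linf_le1 hf hP.1)).
  rewrite -(@ger0_norm _ (s / 2)); last by lra.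
  by rewrite -sqrtr_sqr ler_sqrt// sqr_ge0.
(* At [e = 0] there is no such room, but [f] is then an exact extremiser and the error is [0]. *)
- move=> d X mu T W hT hE f e hf; rewrite le_eqVlt => /predU1P[<-|e0] hG.
    have [b0 f0] := linf_le1_trunc hf.
    have G1 : gowers_aux mu T W n f = 1.
      apply/eqP; rewrite eq_le; move: hG; rewrite subr0 => ->; rewrite andbT.
      rewrite (gowers_aux_trunc hT n hf).
      by have /andP[] := gowers_aux_itv01 hT n b0.
    have [P [hP fP]] := (extremiser _ _ _ _ _ hT hE f hf).1 G1.
    exists P; split=> //; rewrite addr0; apply: le_trans (good_ge0 0).
    have bP := bdisc_exp hP.1.
    apply: (le_trans (L1dist_linf_le1 hf hP.1)).
    rewrite (dist2_ael (u' := fun x => cexp2pi (P x))) //; last first.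
      by apply: filterS2 f0 fP => x <-.
    rewrite (_ : dist2 _ _ _ = 0) ?sqrtr0// -(Rint_cst mu 0).
    by apply: eq_Rintegral => x _; rewrite subrr /abs2 /= expr0n /= addr0.
  have [dl [dl0 hdl] lt] := inf_adherent e0 (inf_good e).
  have [P [hP dP]] := hdl _ _ _ _ _ hT hE f hf hG.
  by exists P; split=> //; apply: le_trans dP (ltW lt).
Unshelve. all: by end_near.
Qed.
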